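(* Suppose the row-stochastic matrix $P$ is irreducible. The following conditions are equivalent. (1) The skew product $F(x,t)=(\sigma x,t+\theta_{x_0})$ is ergodic with respect to $\mu_P\times\mathrm{Leb}$. (2) For every $0\ne k\in\mathbb Z^m$, $1\notin\operatorname{spec}(D_kP)$. (3) For every $0\ne k\in\mathbb Z^m$, there is an admissible directed cycle $(i_0,\ldots,i_{\ell-1},i_\ell=i_0)$ such that $\left\langle k,\sum_{r=0}^{\ell-1}\theta_{i_r}\right\rangle\notin\mathbb Z$.
   Context: $X=\{1,\dots,N\}$; $P=(p_{ij})$ is an $N\times N$ row-stochastic matrix; $\pi(P)$ is its unique stationary probability row vector (all entries positive). $\Sigma=X^{\mathbb N}$ with left shift $\sigma$, and $\mu_P$ is the stationary Markov measure $\mu_P([i_0,\dots,i_n])=\pi_{i_0}(P)p_{i_0i_1}\cdots p_{i_{n-1}i_n}$. $\mathbb T^m=\mathbb R^m/\mathbb Z^m$ has Haar probability $\mathrm{Leb}$, and $\theta_1,\dots,\theta_N\in\mathbb T^m$. The map $F$ acts on $\Sigma\times\mathbb T^m$ and preserves $\mu_P\times\mathrm{Leb}$. $D_k=\operatorname{diag}(e^{2\pi i\langle k,\theta_1\rangle},\ldots,e^{2\pi i\langle k,\theta_N\rangle})$. An edge $i\to j$ is admissible if $p_{ij}>0$, and an admissible directed cycle is one all of whose edges are admissible; ''$\notin\mathbb Z$'' means nonzero in $\mathbb R/\mathbb Z$. *)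

(* Defs.v *)
From HB Require Import structures.
From mathcomp Require Import all_boot all_order all_algebra.
From mathcomp Require Import ring_quotient complex.
From mathcomp Require Import all_classical all_reals all_analysis.

Set Implicit Arguments.
Unset Strict Implicit.
Unset Printing Implicit Defensive.

Import Order.TTheory GRing.Theory Num.Theory.
Import numFieldNormedType.Exports.

Local Open Scope classical_set_scope.
Local Open Scope ring_scope.
Local Open Scope quotient_scope.

Definition int_line (R : realType) : {pred R} := [pred x | x \is a Num.int].

Lemma int_line_zmod_closed (R : realType) : zmod_closed (@int_line R).
Proof. by split=> [|x y]; rewrite !inE ?rpred0//; exact: rpredB. Qed.

HB.instance Definition _ (R : realType) :=
  GRing.isZmodClosed.Build R (@int_line R) (@int_line_zmod_closed R).

Definition int_lattice (R : realType) (m : nat) : {pred 'rV[R]_m} :=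
  [pred v | v \is a mxOver Num.int].

Lemma int_lattice_zmod_closed (R : realType) (m : nat) :
  zmod_closed (@int_lattice R m).
Proof.
split=> [|x y]; rewrite !inE.
  by apply/mxOverP => i j; rewrite mxE rpred0.
by move=> /mxOverP xZ /mxOverP yZ; apply/mxOverP => i j; rewrite !mxE rpredB.
Qed.

HB.instance Definition _ (R : realType) (m : nat) :=
  GRing.isZmodClosed.Build 'rV[R]_m (@int_lattice R m)
    (@int_lattice_zmod_closed R m).

Definition circle (R : realType) : zmodType := Quotient.quot (@int_line R).

Definition torus (R : realType) (m : nat) : Type :=
  quotient_topology (Quotient.quot (@int_lattice R m)).

HB.instance Definition _ (R : realType) (m : nat) := Quotient.on (torus R m).
HB.instance Definition _ (R : realType) (m : nat) := Topological.on (torus R m).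
HB.instance Definition _ (R : realType) (m : nat) := Pointed.on (torus R m).
HB.instance Definition _ (R : realType) (m : nat) :=
  GRing.Zmodule.copy (torus R m) (Quotient.quot (@int_lattice R m)).

(* The sigma-algebra of the torus is its Borel sigma-algebra. *)
HB.instance Definition _ (R : realType) (m : nat) :=
  @isMeasurable.Build (sigma_display (@open (torus R m))) (torus R m)
    <<s @open (torus R m) >> (@sigma_algebra0 _ setT _)
    (@sigma_algebraC _ _) (@sigma_algebra_bigcup _ setT _).

Definition haar_probability (R : realType) (m : nat)
    (Leb : probability (torus R m) R) :=
  forall (s : torus R m) (A : set (torus R m)), measurable A ->
    Leb [set t | A (t + s)] = Leb A.

(* <k, t> in R/Z; see [pairing_pi] for independence of the representative. *)
Definition pairing (R : realType) (m : nat) (k : 'rV[int]_m) (t : torus R m) :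
    circle R :=
  \pi_(circle R) (\sum_(j < m) (k 0 j)%:~R * (repr t) 0 j).

(* u |-> exp(2 i pi u) on R/Z; see [e2pi_pi]. *)
Definition e2pi (R : realType) (u : circle R) : R[i] :=
  (cos (2 * pi * repr u) +i* sin (2 * pi * repr u))%C.

Lemma pairing_pi (R : realType) (m : nat) (k : 'rV[int]_m) (v : 'rV[R]_m) :
  pairing k (\pi_(torus R m) v) =
  \pi_(circle R) (\sum_(j < m) (k 0 j)%:~R * v 0 j).
Proof.
apply/eqP; rewrite -Quotient.idealrBE inE -sumrB; apply: rpred_sum => j _.
rewrite -mulrBr rpredM ?intr_int//.
have : repr (\pi_(torus R m) v) == v %[mod Quotient.quot (@int_lattice R m)].
  by apply/eqP; exact: (reprK (\pi_(torus R m) v)).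
rewrite -Quotient.idealrBE inE => /mxOverP/(_ 0 j).
by rewrite !mxE.
Qed.

Lemma pi_torusD (R : realType) (m : nat) (u v : 'rV[R]_m) :
  \pi_(torus R m) (u + v) = \pi_(torus R m) u + \pi_(torus R m) v.
Proof. exact: (@Quotient.pi_add _ (@int_lattice R m)). Qed.

Lemma pairingD (R : realType) (m : nat) (k : 'rV[int]_m) (s t : torus R m) :
  pairing k (s + t) = pairing k s + pairing k t.
Proof.
rewrite -[s]reprK -[t]reprK -pi_torusD !pairing_pi.
rewrite -[RHS](@Quotient.pi_add _ (@int_line R)) -big_split /=.
by congr (\pi_(circle R) _); apply: eq_bigr => j _; rewrite !mxE mulrDr.
Qed.

Lemma e2pi_pi (R : realType) (x : R) :
  e2pi (\pi_(circle R) x) = (cos (2 * pi * x) +i* sin (2 * pi * x))%C.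
Proof.
rewrite /e2pi; set y := repr _.
have : y == x %[mod circle R] by rewrite /y reprK.
rewrite -Quotient.idealrBE inE => /intrP[n xyn].
have -> : y = x + n%:~R by rewrite -xyn addrC subrK.
have e : 2 * pi * (x + n%:~R) = 2 * pi * x + (pi *+ 2) * n%:~R.
  by rewrite mulrDr mulr_natl.
case: n e {xyn} => n ->; rewrite ?NegzE -?pmulrn ?mulrNz -?pmulrn ?mulrN mulr_natr.
  by rewrite (periodicn (@cosD2pi R)) (periodicn (@sinD2pi R)).
set z := _ - _; rewrite -[in RHS](subrK (pi *+ 2 *+ n.+1) (2 * pi * x)).
by rewrite (periodicn (@cosD2pi R)) (periodicn (@sinD2pi R)).
Qed.

Definition shift_space (N : nat) : Type := nat -> 'I_N.+1.

HB.instance Definition _ (N : nat) :=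
  Choice.copy (shift_space N) (nat -> 'I_N.+1).
HB.instance Definition _ (N : nat) :=
  isPointed.Build (shift_space N) (fun=> ord0).

(* The word [w 0, ..., w n] is given by an infinite sequence, of which only   *)
(* the first n.+1 letters matter.                                             *)
Definition cylinder (N n : nat) (w : shift_space N) : set (shift_space N) :=
  [set x | forall r, (r <= n)%N -> x r = w r].

Definition cylinders (N : nat) : set (set (shift_space N)) :=
  [set C | exists n w, C = cylinder n w].

HB.instance Definition _ (N : nat) :=
  @isMeasurable.Build (sigma_display (@cylinders N)) (shift_space N)
    <<s @cylinders N >> (@sigma_algebra0 _ setT _)
    (@sigma_algebraC _ _) (@sigma_algebra_bigcup _ setT _).

Definition shift (N : nat) (x : shift_space N) : shift_space N :=
  fun n => x n.+1.

Definition stochastic (R : realType) (N : nat) (P : 'M[R]_N.+1) :=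
  (forall i j, 0 <= P i j) /\ (forall i, \sum_j P i j = 1).

Definition irreducible (R : realType) (N : nat) (P : 'M[R]_N.+1) :=
  forall i j, exists2 n, (0 < n)%N & 0 < (P ^+ n) i j.

(* For an irreducible stochastic matrix such a vector exists, is unique, and  *)
(* has positive entries.                                                      *)
Definition stationary (R : realType) (N : nat) (P : 'M[R]_N.+1)
    (p : 'rV[R]_N.+1) :=
  [/\ forall i, 0 <= p 0 i, \sum_i p 0 i = 1 & p *m P = p].

Definition markov_measure (R : realType) (N : nat) (P : 'M[R]_N.+1)
    (p : 'rV[R]_N.+1) (mu : probability (shift_space N) R) :=
  forall (n : nat) (w : shift_space N),
    mu (cylinder n w) = (p 0 (w 0%N) * \prod_(r < n) P (w r) (w r.+1))%:E.

(* For a probability measure, the last clause says that invariant sets have   *)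
(* measure 0 or 1.                                                            *)
Definition ergodic d (T : measurableType d) (R : realType)
    (mu : {measure set T -> \bar R}) (f : T -> T) :=
  [/\ measurable_fun setT f,
      forall A, measurable A -> mu (f @^-1` A) = mu A
    & forall A, measurable A -> f @^-1` A = A -> mu A = 0%E \/ mu (~` A) = 0%E].

Definition skew_product (R : realType) (m N : nat)
    (theta : 'I_N.+1 -> torus R m) (z : shift_space N * torus R m) :
    shift_space N * torus R m :=
  (shift z.1, z.2 + theta (z.1 0%N)).

(* The matrix D_k. *)
Definition twist (R : realType) (m N : nat) (theta : 'I_N.+1 -> torus R m)
    (k : 'rV[int]_m) : 'M[R[i]]_N.+1 :=
  diag_mx (\row_i e2pi (pairing k (theta i))).

Definition admissible (R : realType) (N : nat) (P : 'M[R]_N.+1) :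
    rel 'I_N.+1 := [rel i j | 0 < P i j].

(* [cycle] includes the closing edge, so c = [:: i_0; ..; i_(l-1)] encodes     *)
(* the closed walk i_0 -> .. -> i_(l-1) -> i_0; vertices may repeat.          *)
Definition admissible_cycle (R : realType) (N : nat) (P : 'M[R]_N.+1)
    (c : seq 'I_N.+1) : bool :=
  (c != [::]) && cycle (admissible P) c.

(* Main.v *)
Require Import Defs.
From HB Require Import structures.
From mathcomp Require Import all_boot all_order all_algebra.
From mathcomp Require Import ring_quotient complex.
From mathcomp Require Import all_classical all_reals all_analysis.
From mathcomp Require Import measurable_realfun ring lra.

Set Implicit Arguments.
Unset Strict Implicit.
Unset Printing Implicit Defensive.

Import Order.TTheory GRing.Theory Num.Theory.
Import numFieldNormedType.Exports.
Local Open Scope classical_set_scope.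
Local Open Scope ring_scope.
Local Open Scope quotient_scope.

(** The proof rests on one computation about an irreducible stochastic matrix
    [P] with stationary row [p]: if [v_i = eps_i \sum_j P_ij v_j] with all
    [eps_i] of modulus one, then [v_i = eps_i v_j] along every admissible edge
    ([twisted_fixed_edge]).  Indeed the sum of
    [p_i P_ij |v_i - eps_i v_j| ^ 2] over all edges is [0].  With
    [eps_i = e^(2 pi i <k, theta_i>)] this makes the equivalence of the spectral
    and the cycle conditions combinatorial: following a fixed vector around a
    cycle multiplies it by the character of the sum of the angles
    ([cycle_not_eigenvalue]), and if all these characters are trivial, the
    character of the sum of the angles along a walk to a base vertex depends on
    the start of the walk only and is a fixed vector
    ([trivial_cycles_eigenvalue]).

    If [v] is a fixed vector of [D_k P], then [e^(2 pi i <k, t>) v_(x_0)] is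
    almost everywhere invariant under [F].  It takes its values in a half-plane
    on a set of measure 1/2, because a translation of the torus with
    [<k, s> = 1/2] changes its sign; modifying that set on a null set makes it
    strictly invariant, so [F] is not ergodic
    ([eigenfunction_not_ergodic]).

    Conversely, let [A] be invariant.  For each letter [i], the measure
    [nu_i (B) = (mu x Leb) (A, x_0 = i, t in B)] is a mixture of translates of
    the measures [nu_j], by the Markov property ([markov_step]).  On Fourier
    coefficients a translation is a scalar, so [nu_i^(k) / p_i] is a fixed
    vector of [D_(-k) P] ([fourier_slice_fixed]): under the spectral condition
    it vanishes for [k <> 0], while for [k = 0] it is constant in [i].  A
    measure on the torus being determined by its Fourier coefficients
    ([fourier_inj]), [nu_i] is a multiple of [Leb], and the Markov property
    extends this from letters to cylinders.  Hence [A] is independent of every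
    measurable set, in particular of itself, and has measure 0 or 1
    ([invariant_measure01]).

    Uniqueness of Fourier coefficients is obtained by exhibiting enough sets
    whose indicator is a bounded pointwise limit of trigonometric polynomials:
    the sublevel sets [h < 1/2] of trigonometric polynomials [h] with values in
    [0, 1], through the polynomials [(1 - h ^ n) ^ (n 2 ^ n)]. *)

(** * Characters of the circle and of the torus *)

Lemma pi_circleD (R : realType) (x y : R) :
  \pi_(circle R) (x + y) = \pi_(circle R) x + \pi_(circle R) y.
Proof. exact: (@Quotient.pi_add _ (@int_line R)). Qed.

Lemma pi_circle0 (R : realType) : \pi_(circle R) 0 = 0.
Proof. by apply: (addrI (\pi_(circle R) 0)); rewrite -pi_circleD !addr0. Qed.

Lemma pi_circle_int (R : realType) (x : R) (z : int) :
  \pi_(circle R) (x - z%:~R) = \pi_(circle R) x.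
Proof.
apply/eqP; rewrite -Quotient.idealrBE inE addrAC subrr add0r rpredN.
exact: intr_int.
Qed.

Lemma e2piD (R : realType) (u v : circle R) : e2pi (u + v) = e2pi u * e2pi v.
Proof.
rewrite -[u]reprK -[v]reprK -pi_circleD !e2pi_pi mulrDr cosD sinD.
by apply/eqP; rewrite eq_complex /= eqxx addrC eqxx.
Qed.

Lemma e2pi0 (R : realType) : e2pi (0 : circle R) = 1.
Proof.
by rewrite -pi_circle0 e2pi_pi mulr0 cos0 sin0.
Qed.

Lemma e2pi_norm1 (R : realType) (u : circle R) : e2pi u * (e2pi u)^* = 1.
Proof.
rewrite /e2pi; set a := 2 * pi * _; apply/eqP; rewrite eq_complex /=.
by rewrite mulrN opprK -!expr2 cos2Dsin2 eqxx /= mulrN mulrC addNr.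
Qed.

Lemma e2pi_neq0 (R : realType) (u : circle R) : e2pi u != 0.
Proof.
apply/eqP => u0; have := e2pi_norm1 u; rewrite u0 mul0r => /eqP.
by rewrite eq_sym oner_eq0.
Qed.

Lemma e2piN (R : realType) (u : circle R) : e2pi (- u) = (e2pi u)^*.
Proof.
apply: (mulfI (e2pi_neq0 u)).
by rewrite -e2piD subrr e2pi0 e2pi_norm1.
Qed.

Lemma cos_lt1 (R : realType) (x : R) : 0 < x -> x < 2 * pi -> cos x < 1.
Proof.
move=> x0 x2; have -> : x = x / 2 + x / 2 by lra.
rewrite cosD.
have := cos2Dsin2 (x / 2).
have s0 : 0 < sin (x / 2) by apply: sin_gt0_pi; lra.
have := mulr_gt0 s0 s0; rewrite !expr2; lra.
Qed.

Lemma e2pi_eq1 (R : realType) (u : circle R) : e2pi u = 1 -> u = 0.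
Proof.
rewrite -[u]reprK; set x := repr u => e1.
pose f := x - (Num.floor x)%:~R.
have xf : \pi_(circle R) x = \pi_(circle R) f.
  by rewrite pi_circle_int.
have f0 : 0 <= f by rewrite subr_ge0 floor_le.
have f1 : f < 1.
  by rewrite ltrBlDl -intrD1; case/andP: (floor_itv x).
case: (eqVneq f 0) => [f_eq0|f_neq0].
  by rewrite xf f_eq0 pi_circle0.
move: e1; rewrite xf e2pi_pi => -[c1 _].
have p0 := pi_gt0 R.
have fp : 0 < f by rewrite lt_def f_neq0.
have : cos (2 * pi * f) < 1.
  apply: cos_lt1; first by rewrite !mulr_gt0.
  by rewrite -[X in _ < X]mulr1 ltr_pM2l// mulr_gt0.
by rewrite c1 ltxx.
Qed.

Definition chi (R : realType) (m : nat) (k : 'rV[int]_m) (t : torus R m) :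
  R[i] := e2pi (pairing k t).

Section characters.
Variables (R : realType) (m : nat).
Implicit Types (k : 'rV[int]_m) (s t : torus R m).

Lemma chiD k s t : chi k (s + t) = chi k s * chi k t.
Proof. by rewrite /chi pairingD e2piD. Qed.

Lemma pairing0 k : pairing k (0 : torus R m) = 0.
Proof. by apply: (addrI (pairing k 0)); rewrite -pairingD !addr0. Qed.

Lemma chi_sum k (I : Type) (s : seq I) (f : I -> torus R m) :
  chi k (\sum_(i <- s) f i) = \prod_(i <- s) chi k (f i).
Proof.
elim: s => [|i s IHs]; first by rewrite !big_nil /chi pairing0 e2pi0.
by rewrite !big_cons chiD IHs.
Qed.

End characters.

(** * Walks and fixed vectors of twisted stochastic matrices *)

Section matrix.
Variables (R : realType) (N : nat) (P : 'M[R]_N.+1).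
Hypotheses (P_stochastic : stochastic P) (P_irreducible : irreducible P).

Lemma stochasticX_ge0 n i j : 0 <= (P ^+ n) i j.
Proof.
elim: n i j => [|n IHn] i j; first by rewrite expr0 mxE ler0n.
by rewrite exprS mxE; apply: sumr_ge0 => k _; rewrite mulr_ge0//;
  apply P_stochastic.
Qed.

Lemma walk_of_expr n i j : 0 < (P ^+ n) i j ->
  exists2 s, path (admissible P) i s & last i s = j.
Proof.
elim: n i => [|n IHn] i.
  rewrite expr0 mxE; case: (eqVneq i j) => [->|_]; first by exists [::].
  by rewrite ltxx.
rewrite exprS mxE => sum_gt0.
have /existsP[k /andP[Pik Pkj]] : [exists k, (0 < P i k) && (0 < (P ^+ n) k j)].
  apply: contraTT sum_gt0 => /existsPn no_k; rewrite -leNgt.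
  apply: sumr_le0 => k _; move: (no_k k); rewrite negb_and -!leNgt.
  case/orP => le0.
    have /eqP -> : P i k == 0 by rewrite eq_le le0; apply P_stochastic.
    by rewrite mul0r.
  have /eqP -> : (P ^+ n) k j == 0 by rewrite eq_le le0 stochasticX_ge0.
  by rewrite mulr0.
have [s ks <-] := IHn _ Pkj.
by exists (k :: s) => //; apply/andP.
Qed.

Lemma irreducible_walk i j : exists2 s, path (admissible P) i s & last i s = j.
Proof. by have [n _ /walk_of_expr] := P_irreducible i j. Qed.

Lemma closed_walk_cycle i s : path (admissible P) i s -> last i s = i ->
  s != [::] -> admissible_cycle P (belast i s).
Proof.
case/lastP: s => // r x; rewrite last_rcons => + xi _; rewrite xi => ir.
by rewrite /admissible_cycle belast_rcons /= ir.
Qed.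

Lemma walk_invariant (Q : 'I_N.+1 -> Prop) i :
  (forall a b, 0 < P a b -> Q a -> Q b) -> Q i -> forall j, Q j.
Proof.
move=> Qedge Qi j; have [s + <-] := irreducible_walk i j.
elim: s i Qi => [|a s IHs] i Qi //= /andP[ia sa].
by apply: IHs => //; apply: Qedge ia Qi.
Qed.

Variable p : 'rV[R]_N.+1.
Hypothesis p_stationary : stationary P p.

Lemma stationary_gt0 j : 0 < p 0 j.
Proof.
have [p_ge0 p_sum pP] := p_stationary.
have /existsP[i pi_gt0] : [exists i, 0 < p 0 i].
  apply: contraPT p_sum => /existsPn no_i.
  rewrite big1 ?(rwP eqP) 1?eq_sym ?oner_eq0// => i _.
  by apply/eqP; rewrite eq_le p_ge0 andbT leNgt.
have [n _ Pij] := P_irreducible i j.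
have -> : p = p *m P ^+ n.
  elim: n {Pij} => [|n IHn]; first by rewrite expr0 mulmx1.
  by rewrite exprS -[_ * _]/(_ *m _) mulmxA pP.
rewrite mxE (bigD1 i)//= ltr_pwDl ?mulr_gt0//.
by apply: sumr_ge0 => k _; rewrite mulr_ge0// stochasticX_ge0.
Qed.

(** The Dirichlet form [\sum_(i, j) p_i P_ij |v_i - eps_i v_j|^2] vanishes on a
    vector fixed by the twisted matrix: expanding the square, the cross terms
    give [- 2 |v_i|^2], and stationarity of [p] makes the remaining squares
    cancel.  Every term being nonnegative, each of them is zero. *)
Lemma twisted_fixed_edge (eps v : 'I_N.+1 -> R[i]) :
    (forall i, eps i * (eps i)^* = 1) ->
    (forall i, v i = eps i * \sum_j (P i j)%:C%C * v j) ->
  forall i j, 0 < P i j -> v i = eps i * v j.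
Proof.
move=> eps1 vfix i j Pij; have [p_ge0 p_sum pP] := p_stationary.
pose E i j := (p 0 i * P i j)%:C%C * ((v i - eps i * v j)
  * (v i - eps i * v j)^*).
have E_ge0 a b : 0 <= E a b.
  apply: mulr_ge0; last by rewrite -normCK exprn_ge0.
  by rewrite lecR mulr_ge0//; apply P_stochastic.
have row a : \sum_b E a b =
    \sum_b (p 0 a * P a b)%:C%C * (v b * (v b)^*)
      - (p 0 a)%:C%C * (v a * (v a)^*).
  have Ea b : E a b = (p 0 a * P a b)%:C%C * (v b * (v b)^*)
      + ((p 0 a)%:C%C * (v a * (v a)^*)) * (P a b)%:C%C
      - (p 0 a)%:C%C * v a * (eps a * ((P a b)%:C%C * v b))^*
      - (p 0 a)%:C%C * (v a)^* * (eps a * ((P a b)%:C%C * v b)).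
    rewrite /E !rmorphM !rmorphB !rmorphM /=.
    have -> : ((P a b)%:C%C)^* = (P a b)%:C%C :> R[i].
      by apply/eqP; rewrite eq_complex /= oppr0 !eqxx.
    have := eps1 a; move: (eps a) ((eps a)^*) (v b) ((v b)^*) => e e' x x' ee'.
    transitivity ((p 0 a)%:C%C * (P a b)%:C%C * (v a * (v a)^*
      - v a * e' * x' - (v a)^* * e * x + (e * e') * x * x')); first by ring.
    by rewrite ee'; ring.
  rewrite (eq_bigr _ (fun b _ => Ea b)) !sumrB big_split /= -!mulr_sumr.
  rewrite -rmorph_sum -rmorph_sum (proj2 P_stochastic a) /= -mulr_sumr -vfix.
  ring.
have tot : \sum_a \sum_b E a b = 0.
  rewrite (eq_bigr _ (fun a _ => row a)) sumrB exchange_big /=.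
  rewrite -sumrB big1// => b _; rewrite -mulr_suml -mulrBl.
  suff -> : \sum_a (p 0 a * P a b)%:C%C =
    (p 0 b)%:C%C :> R[i] by rewrite subrr mul0r.
  by rewrite -rmorph_sum -[in RHS]pP mxE.
move/eqP: tot; rewrite psumr_eq0; last by move=> a _; apply: sumr_ge0.
move=> /allP/(_ i); rewrite mem_index_enum => /(_ isT) /=.
rewrite psumr_eq0 // => /allP/(_ j); rewrite mem_index_enum => /(_ isT) /=.
rewrite /E mulf_eq0 => /orP[|].
  by rewrite fmorph_eq0 mulf_eq0 !gt_eqF//= stationary_gt0.
by rewrite -normCK sqrf_eq0 normr_eq0 subr_eq0 => /eqP.
Qed.

Lemma twisted_path (eps v : 'I_N.+1 -> R[i]) :
    (forall i j, 0 < P i j -> v i = eps i * v j) ->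
  forall i s, path (admissible P) i s ->
    v i = (\prod_(a <- belast i s) eps a) * v (last i s).
Proof.
move=> edge i s; elim: s i => [|a s IHs] i /=; first by rewrite big_nil mul1r.
by move=> /andP[ia /IHs va]; rewrite big_cons -mulrA -va; apply: edge.
Qed.

(** Along an edge, [v] vanishes at both ends or at none, and every vertex is
    reached from [i]. *)
Lemma twisted_neq0 (eps v : 'I_N.+1 -> R[i]) i :
    (forall i, eps i != 0) ->
    (forall i j, 0 < P i j -> v i = eps i * v j) ->
  v i != 0 -> forall j, v j != 0.
Proof.
move=> eps0 edge vi; apply: (walk_invariant (Q := fun j => v j != 0) _ vi).
by move=> a b Pab; rewrite (edge _ _ Pab) mulf_eq0 negb_or => /andP[].
Qed.

End matrix.

(** * The spectral condition and the cycle condition *)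

Lemma eigenvalue1_fixed (F : fieldType) (n : nat) (A : 'M[F]_n) :
  eigenvalue A 1 <-> exists2 v : 'cV_n, v != 0 & A *m v = v.
Proof.
have kerE (B : 'M[F]_n) :
    (exists2 u : 'rV_n, u != 0 & u *m B = 0) <-> B \notin unitmx.
  rewrite -row_free_unit -kermx_eq0; split=> [[u u0 uB]|/rowV0Pn[u uB u0]].
    by apply/rowV0Pn; exists u => //; apply/sub_kermxP.
  by exists u => //; apply/sub_kermxP.
rewrite /eigenvalue /eigenspace kermx_eq0 row_free_unit -unitmx_tr.
rewrite -kerE; split=> [[u u0 uB]|[v v0 Av]].
  exists u^T; first by rewrite -[0]trmx0 (inj_eq trmx_inj).
  apply: trmx_inj; apply/eqP; rewrite trmx_mul trmxK -subr_eq0 -{2}[u]mulmx1.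
  by rewrite -mulmxBr -trmx1 -linearB uB.
exists v^T; first by rewrite -[0]trmx0 (inj_eq trmx_inj).
by rewrite -trmx_mul mulmxBl mul1mx Av subrr trmx0.
Qed.

Section spectral_cycle.
Variables (R : realType) (N m : nat) (P : 'M[R]_N.+1).
Hypotheses (P_stochastic : stochastic P) (P_irreducible : irreducible P).
Variable theta : 'I_N.+1 -> torus R m.

Lemma twist_fixedE k (v : 'cV[R[i]]_N.+1) :
  twist theta k *m map_mx (real_complex R) P *m v = v <->
  forall i, v i 0 = chi k (theta i) * \sum_j (P i j)%:C%C * v j 0.
Proof.
have E i : (twist theta k *m map_mx (real_complex R) P *m v) i 0 =
    chi k (theta i) * \sum_j (P i j)%:C%C * v j 0.
  rewrite mxE mulr_sumr; apply: eq_bigr => j _.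
  by rewrite mul_diag_mx !mxE mulrA.
split=> [fixv i|fixv]; first by rewrite -[in LHS]fixv E.
by apply/matrixP => i j; rewrite ord1 E -fixv.
Qed.

(** For a fixed vector [v] of [D_k P], multiplying the edge relations
    [v_i = chi k (theta i) v_j] along the cycle leaves
    [v_i = chi k (sum of theta) v_i], and [v_i] is nonzero. *)
Lemma cycle_not_eigenvalue (p : 'rV[R]_N.+1) k c : stationary P p ->
  admissible_cycle P c -> pairing k (\sum_(i <- c) theta i) != 0 ->
  ~~ eigenvalue (twist theta k *m map_mx (real_complex R) P) 1.
Proof.
move=> p_stat /andP[]; case: c => // i c _ /= ic; apply: contraNN.
move=> /eigenvalue1_fixed[v v0 /twist_fixedE fixv].
have edge := twisted_fixed_edge P_stochastic P_irreducible p_stat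
  (fun i => e2pi_norm1 (pairing k (theta i))) fixv.
have [j vj] : exists j, v j 0 != 0.
  by have /cV0Pn := v0.
have vi := twisted_neq0 P_stochastic P_irreducible (fun i => e2pi_neq0 _)
  edge vj i.
have := twisted_path edge ic.
rewrite belast_rcons last_rcons -/(chi _ _) => /eqP.
rewrite -[X in X == _]mul1r (inj_eq (mulIf vi)) -chi_sum eq_sym => /eqP.
by move=> /e2pi_eq1 ->.
Qed.

(** The fixed vector is [chi k] of the sum of the angles along a walk from [i]
    to a base vertex: two such walks are closed into cycles by a common return
    walk, so that the value depends on [i] only. *)
Lemma trivial_cycles_eigenvalue k :
    (forall c, admissible_cycle P c -> pairing k (\sum_(i <- c) theta i) = 0) ->
  eigenvalue (twist theta k *m map_mx (real_complex R) P) 1.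
Proof.
move=> trivial_cycle.
pose w i s := chi k (\sum_(a <- belast i s) theta a).
have closed_walk i s : path (admissible P) i s -> last i s = i -> w i s = 1.
  case: (eqVneq s [::]) => [-> _ _|s0 is_ lasts].
    by rewrite /w big_nil /chi pairing0 e2pi0.
  by rewrite /w /chi (trivial_cycle _ (closed_walk_cycle is_ lasts s0)) e2pi0.
have w_cat i s s' : w i (s ++ s') = w i s * w (last i s) s'.
  by rewrite /w belast_cat big_cat chiD.
have unique i s s' : path (admissible P) i s -> path (admissible P) i s' ->
    last i s = last i s' -> w i s = w i s'.
  move=> is_ is' slast; have [r ir rlast] :=
    irreducible_walk P_stochastic P_irreducible (last i s) i.
  have : w (last i s) r != 0 by exact: e2pi_neq0.
  move/mulIf; apply; rewrite {2}slast -!w_cat !closed_walk ?cat_path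
    ?last_cat//.
  - by rewrite is' -slast.
  - by rewrite -slast.
  - by rewrite is_.
have walk i : exists s, path (admissible P) i s /\ last i s = ord0.
  by have [s] := irreducible_walk P_stochastic P_irreducible i ord0; exists s.
have [to0 to0P] := choice walk.
apply/eigenvalue1_fixed; exists (\col_i w i (to0 i)).
  apply/cV0Pn; exists ord0; rewrite mxE; exact: e2pi_neq0.
apply/twist_fixedE => i; rewrite mxE.
have edge j : 0 < P i j -> w i (to0 i) = chi k (theta i) * w j (to0 j).
  move=> Pij; have [ji jlast] := to0P j; have [ii ilast] := to0P i.
  rewrite (@unique i (to0 i) (j :: to0 j))//.
  - by rewrite /w /= big_cons chiD.
  - by apply/andP.
  - by rewrite ilast.
rewrite mulr_sumr (eq_bigr (fun j => (P i j)%:C%C * w i (to0 i))).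
  by rewrite -mulr_suml -rmorph_sum (proj2 P_stochastic) mul1r.
move=> j _; rewrite !mxE mulrCA.
case: (ltrP 0 (P i j)) => [/edge <-//|Pij].
have -> : P i j = 0 by apply/eqP; rewrite eq_le Pij (proj1 P_stochastic).
by rewrite !mul0r.
Qed.

End spectral_cycle.

(** * Trigonometric polynomials generate the Borel sets of the torus *)

(** The Bernoulli inequality. *)
Lemma bernoulli_le (R : realDomainType) (a : R) n : -1 <= a ->
  1 + n%:R * a <= (1 + a) ^+ n.
Proof.
move=> a1; elim: n => [|n IHn]; first by rewrite mul0r addr0 expr0.
have a0 : 0 <= 1 + a by lra.
rewrite exprS; apply: le_trans (ler_wpM2l a0 IHn).
rewrite -natr1; have : 0 <= n%:R * a ^+ 2 by rewrite mulr_ge0 ?sqr_ge0.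
by rewrite expr2; move: (n%:R : R) => x; nra.
Qed.

Lemma cvg_natM_expr (R : realType) (z : R) : 0 <= z < 1 ->
  (n%:R * z ^+ n) @[n --> \oo] --> (0 : R).
Proof.
move=> /andP[z0 z1].
(* As [z <= w ^ 2], the sequence is at most [(n w ^ n) w ^ n], whose first
   factor is bounded. *)
pose w := (1 + z) / 2.
have w0 : 0 < w by rewrite /w; lra.
have w1 : w < 1 by rewrite /w; lra.
have zw : z <= w * w by rewrite /w; nra.
pose C := (w^-1 - 1)^-1.
have Cp : 0 < w^-1 - 1 by rewrite subr_gt0 invf_gt1.
have wn n : n%:R * w ^+ n <= C.
  rewrite /C -[leRHS]mul1r ler_pdivlMr// -[leRHS](@mulVf _ (w ^+ n))
    ?expf_neq0 ?gt_eqF//.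
  rewrite mulrAC ler_wpM2r ?exprn_ge0 ?(ltW w0)// -exprVn.
  have w1n : -1 <= w^-1 - 1 by lra.
  have := bernoulli_le n w1n; rewrite (addrC 1 (w^-1 - 1)) subrK;
    apply: le_trans.
  by rewrite lerDr.
apply: (@squeeze_cvgr _ _ _ _ (fun=> 0) (geometric C w)); last 2 first.
- exact: cvg_cst.
- by apply: cvg_geometric; rewrite ger0_norm ?ltW.
apply: nearW => n; rewrite mulr_ge0 ?exprn_ge0//=.
apply: le_trans (ler_wpM2l _ (_ : z ^+ n <= w ^+ n * w ^+ n)) _ => //.
  by rewrite -exprMn; apply: lerXn2r => //; rewrite nnegrE// mulr_ge0// ltW.
by rewrite mulrA ler_wpM2r ?exprn_ge0 ?(ltW w0).
Qed.

(** The exponent [n 2^n] outruns [2^n], so that the limit at the threshold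
    [1/2] itself is [0]. *)
Lemma cvg_step (R : realType) (x : R) : 0 <= x <= 1 ->
  ((1 - x ^+ n) ^+ (n * 2 ^ n)) @[n --> \oo] --> ((x < 1 / 2)%R%:R : R).
Proof.
move=> /andP[x0 x1].
have xn n : 0 <= x ^+ n <= 1 by rewrite exprn_ge0// exprn_ile1.
case: ltrP => x2.
  apply: (@squeeze_cvgr _ _ _ _ (fun n => 1 - n%:R * (2 * x) ^+ n) (fun=> 1)).
  - apply: nearW => n; have /andP[xn0 xn1] := xn n.
    rewrite exprn_ile1 ?andbT; last 2 first.
    + by rewrite subr_ge0.
    + by rewrite lerBlDr lerDl.
    apply: le_trans (bernoulli_le _ _); last by rewrite lerN2.
    by rewrite mulrN natrM natrX exprMn mulrA.
  - rewrite -[X in _ --> X]subr0; apply: cvgB; first exact: cvg_cst.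
    by apply: cvg_natM_expr; lra.
  - exact: cvg_cst.
apply: (@squeeze_cvgr _ _ _ _ (fun=> 0) harmonic); last 2 first.
- exact: cvg_cst.
- exact: cvg_harmonic.
apply: nearW => n; have /andP[xn0 xn1] := xn n.
rewrite exprn_ge0 ?subr_ge0//= -[leRHS]mul1r ler_pdivlMr//.
have le1 : ((1 - x ^+ n) * (1 + x ^+ n)) ^+ (n * 2 ^ n) <= 1.
  by apply: exprn_ile1; nra.
apply: le_trans le1; rewrite exprMn ler_wpM2l ?exprn_ge0 ?subr_ge0//.
apply: le_trans (bernoulli_le _ _); last by lra.
rewrite -natr1 addrC lerD2l natrM natrX -mulrA -exprMn -[leLHS]mulr1.
by rewrite ler_wpM2l// exprn_ege1//; lra.
Qed.

Section torus_functions.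
Variables (R : realType) (m : nat).
Implicit Types (k : 'rV[int]_m) (s t : torus R m) (v : 'rV[R]_m).

Lemma Re_chi_pi (c : R[i]) k v :
  complex.Re (c * chi k (\pi_(torus R m) v)) =
  complex.Re c * cos (2 * pi * \sum_(j < m) (k 0 j)%:~R * v 0 j)
  - complex.Im c * sin (2 * pi * \sum_(j < m) (k 0 j)%:~R * v 0 j).
Proof. by rewrite /chi pairing_pi e2pi_pi; case: c. Qed.

Lemma torus_preimage_measurable (f : torus R m -> R) (B : set R) :
  continuous f -> open B -> measurable (f @^-1` B).
Proof.
by move=> /continuousP cf /cf oB; apply: sub_sigma_algebra.
Qed.

Lemma torus_continuous_measurable (f : torus R m -> R) :
  continuous f -> measurable_fun setT f.
Proof.
move=> cf; apply: (measurability _ (measurable_realfun.RGenOpens.measurableE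
  R)) => _ [_ [a [b ->] <-]].
rewrite setTI; apply: torus_preimage_measurable => //; exact: itv_open.
Qed.

Lemma continuous_linear_form k :
  continuous (fun v : 'rV[R]_m => \sum_(j < m) (k 0 j)%:~R * v 0 j).
Proof.
apply: continuous_big => [|j _ v]; first exact: add_continuous.
apply: (@cvgMl_tmp R _ (nbhs v)); exact: coord_continuous.
Qed.

Lemma Re_chi_continuous (c : R[i]) k :
  continuous (fun t : torus R m => complex.Re (c * chi k t)).
Proof.
apply/quotient_continuous.
rewrite (_ : _ \o _ = fun v => complex.Re c * cos (2 * pi * \sum_(j < m)
  (k 0 j)%:~R * v 0 j)
  - complex.Im c * sin (2 * pi * \sum_(j < m) (k 0 j)%:~R * v 0 j)); last first.
  by apply/funext => v; exact: Re_chi_pi.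
pose l (w : 'rV[R]_m) : R := 2 * pi * \sum_(j < m) (k 0 j)%:~R * w 0 j.
have cl v : l w @[w --> v] --> l v.
  by apply: (@cvgMl_tmp R _ (nbhs v)); exact: continuous_linear_form.
move=> v.
have lcos : complex.Re c * cos (l w) @[w --> v] --> complex.Re c * cos (l v).
  apply: (@cvgMl_tmp R _ (nbhs v)).
  exact: (@cvg_comp _ _ _ l cos (nbhs v) _ _ (cl v) (@continuous_cos R _)).
have lsin : complex.Im c * sin (l w) @[w --> v] --> complex.Im c * sin (l v).
  apply: (@cvgMl_tmp R _ (nbhs v)).
  exact: (@cvg_comp _ _ _ l sin (nbhs v) _ _ (cl v) (@continuous_sin R _)).
exact: cvgB lcos lsin.
Qed.

Lemma torus_translation_measurable s : measurable_fun setT (fun t => t + s).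
Proof.
apply: (measurability (@open (torus R m))) => // _ [U oU <-].
rewrite setTI; apply: sub_sigma_algebra.
rewrite -[s]reprK.
have /continuousP cadd : continuous (fun v => v + repr s).
  by move=> v; exact: cvgD (@cvg_id _ _) (@cvg_cst _ _ _ _ _).
have := cadd _ (oU : open (\pi_(torus R m) @^-1` U)).
congr open; apply/seteqP; split=> v /=; by rewrite pi_torusD.
Qed.

Lemma chiN k t : chi (- k) t = (chi k t)^*.
Proof.
rewrite -[t]reprK /chi !pairing_pi -e2piN; congr e2pi.
apply: (addrI (\pi_(circle R) (\sum_(j < m) (k 0 j)%:~R * repr t 0 j))).
rewrite -pi_circleD subrr -big_split big1 ?pi_circle0// => j _ /=.
by rewrite mxE mulrNz mulNr subrr.
Qed.

Lemma chi_freqD k l t : chi (k + l) t = chi k t * chi l t.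
Proof.
rewrite -[t]reprK /chi !pairing_pi -e2piD -pi_circleD -big_split; congr e2pi.
by congr (\pi_(circle R) _); apply: eq_bigr => j _; rewrite mxE intrD mulrDl.
Qed.

Lemma chi0 t : chi 0 t = 1.
Proof.
apply: (mulfI (e2pi_neq0 (pairing 0 t))).
by rewrite -[_ * _]chi_freqD addr0 mulr1.
Qed.

Lemma chi_opp k t : chi k (- t) = chi (- k) t.
Proof.
apply: (mulfI (e2pi_neq0 (pairing k t)));
  rewrite -[LHS]chiD -[RHS]chi_freqD !subrr.
by rewrite chi0 /chi pairing0 e2pi0.
Qed.

Inductive trig_poly : (torus R m -> R) -> Prop :=
| trig_wave c k : trig_poly (fun t => complex.Re (c * chi k t))
| trig_add f g : trig_poly f -> trig_poly g -> trig_poly (fun t => f t + g t).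

Lemma trig_cst c : trig_poly (fun=> c).
Proof.
rewrite (_ : (fun=> c) = fun t => complex.Re (c%:C%C * chi 0 t));
  first exact: trig_wave.
by apply/funext => t; rewrite chi0 mulr1.
Qed.

Lemma ReM_half (a b : R[i]) :
  complex.Re a * complex.Re b = complex.Re (2^-1%:C%C * (a * b))
    + complex.Re (2^-1%:C%C * (a * b^*)).
Proof. by case: a => a a'; case: b => b b' /=; field. Qed.

Lemma trig_mul f g : trig_poly f -> trig_poly g ->
    trig_poly (fun t => f t * g t).
Proof.
move=> tf tg; elim: tf => [c k|f1 f2 _ tf1 _ tf2]; last first.
  by under eq_fun do rewrite mulrDl; exact: trig_add.
elim: tg => [d l|g1 g2 _ tg1 _ tg2]; last first.
  by under eq_fun do rewrite mulrDr; exact: trig_add.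
under eq_fun => t.
  rewrite ReM_half rmorphM /= -chiN mulrACA -chi_freqD mulrACA -chi_freqD
    !mulrA.
  over.
by apply: trig_add; exact: trig_wave.
Qed.

Lemma trig_scale a f : trig_poly f -> trig_poly (fun t => a * f t).
Proof. by apply: trig_mul; exact: trig_cst. Qed.

Lemma trig_exp f n : trig_poly f -> trig_poly (fun t => f t ^+ n).
Proof.
move=> tf; elim: n => [|n IHn]; first exact: trig_cst.
by under eq_fun do rewrite exprS; exact: trig_mul.
Qed.

Lemma trig_sum (I : Type) (s : seq I) (f : I -> torus R m -> R) :
  (forall i, trig_poly (f i)) -> trig_poly (fun t => \sum_(i <- s) f i t).
Proof.
move=> tf; elim: s => [|i s IHs].
  by under eq_fun do rewrite big_nil; exact: trig_cst.
by under eq_fun do rewrite big_cons; exact: trig_add.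
Qed.

Lemma trig_continuous f : trig_poly f -> continuous f.
Proof.
elim=> [c k|{}f g _ cf _ cg]; first exact: Re_chi_continuous.
by move=> t; exact: cvgD (cf t) (cg t).
Qed.

Lemma trig_measurable f : trig_poly f -> measurable_fun setT f.
Proof. by move=> /trig_continuous; exact: torus_continuous_measurable. Qed.

(** Sets whose indicator is a pointwise limit of trigonometric polynomials
    with values in [0, 1]; by dominated convergence a measure is determined on
    them by its Fourier coefficients. *)
Definition trig_set (G : set (torus R m)) :=
  measurable G /\ exists u : nat -> torus R m -> R,
    [/\ forall n, trig_poly (u n), forall n t, 0 <= u n t <= 1
      & forall t, u n t @[n --> \oo] --> (\1_G t : R)].

Lemma trig_setI : setI_closed trig_set.
Proof.
move=> G H [mG [u [tu u01 uG]]] [mH [w [tw w01 wH]]].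
split; first exact: measurableI.
exists (fun n t => u n t * w n t); split=> [n|n t|t].
- exact: trig_mul.
- by case/andP: (u01 n t) => ? ?; case/andP: (w01 n t) => ? ?; nra.
- by rewrite indicI; apply: cvgM.
Qed.

(** The limit of [cvg_step], applied to the values of [h]. *)
Lemma trig_set_sublevel h : trig_poly h -> (forall t, 0 <= h t <= 1) ->
  trig_set [set t | h t < 1 / 2].
Proof.
move=> th h01; split.
  have := torus_preimage_measurable (B := [set x | x < 1 / 2])
    (trig_continuous th).
  by apply; exact: open_lt.
exists (fun n t => (1 - h t ^+ n) ^+ (n * 2 ^ n)); split=> [n|n t|t].
- apply: trig_exp; apply: trig_add; first exact: trig_cst.
  by under eq_fun do rewrite -mulN1r; apply: trig_scale; exact: trig_exp.
- have /andP[h0 h1] := h01 t.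
  have /andP[a0 a1] : 0 <= h t ^+ n <= 1 by rewrite exprn_ge0// exprn_ile1.
  by rewrite exprn_ge0 ?exprn_ile1 ?subr_ge0// lerBlDr lerDl.
- rewrite indicE; have := cvg_step (h01 t).
  by rewrite -(_ : (t \in [set t | h t < 1 / 2]) = (h t < 1 / 2))//;
    apply/idP/idP; rewrite inE.
Qed.

Lemma trig_setT : trig_set setT.
Proof.
have -> : setT = [set t : torus R m | (fun=> 0) t < 1 / 2 :> R].
  by apply/seteqP; split=> // t _ /=; lra.
by apply: trig_set_sublevel => [|t]; [exact: trig_cst | rewrite lexx ler01].
Qed.

End torus_functions.

(** [cos (2 pi x)] is a decreasing function of the distance from [x] to the
    integers. *)
Lemma cos_gt_near_int (R : realType) (x d : R) : 0 <= d <= 1 / 2 ->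
  cos (2 * pi * d) < cos (2 * pi * x) -> exists z : int, `|x - z%:~R| < d.
Proof.
move=> /andP[d0 d2] cosx; pose z := Num.floor (x + 1 / 2); exists z.
have p0 := pi_gt0 R.
have /andP[zl zu] := floor_itv (x + 1 / 2); rewrite intrD1 in zu.
rewrite -/z in zl zu; set e := x - z%:~R.
have ele : `|e| <= 1 / 2 by rewrite ler_norml /e; apply/andP; split; lra.
have cosE : cos (2 * pi * x) = cos (2 * pi * `|e|).
  have := e2pi_pi x; rewrite -(pi_circle_int x z) e2pi_pi => -[<- _].
  by rewrite -/e; case: (ger0P e) => // _; rewrite mulrN cosN.
move: cosx; rewrite cosE ltr_cos ?in_itv /=.
- by rewrite ltr_pM2l// mulr_gt0.
- by apply/andP; split; [rewrite !mulr_ge0 // ltW | nra].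
- by apply/andP; split; [rewrite !mulr_ge0 // ltW | have := normr_ge0 e; nra].
Qed.

Section trig_sets_generate.
Variables (R : realType) (m : nat).
Implicit Types (q : 'rV[rat]_m) (s t : torus R m) (v : 'rV[R]_m).

(** The squared distance from [t] to [q] for the chords of the unit circles,
    up to a factor [2].  It is a trigonometric polynomial, and rational centres
    make its balls countably many. *)
Definition chordal q t : R :=
  \sum_(j < m) (1 - complex.Re (e2pi (\pi_(circle R) (- ratr (q 0 j)))
    * chi (delta_mx 0 j) t)).

Lemma chordal_pi q v :
  chordal q (\pi_(torus R m) v) = \sum_(j < m)
    (1 - cos (2 * pi * (v 0 j - ratr (q 0 j)))).
Proof.
apply: eq_bigr => j _; rewrite /chi pairing_pi -e2piD -pi_circleD e2pi_pi /=.
congr (1 - cos (2 * pi * _)); rewrite addrC (bigD1 j)//= mxE !eqxx mul1r.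
by rewrite big1 ?addr0// => l lj; rewrite mxE (negbTE lj) mul0r.
Qed.

Lemma trig_chordal q : trig_poly (chordal q).
Proof.
apply: trig_sum => j; apply: trig_add; first exact: trig_cst.
by under eq_fun do rewrite -mulN1r; apply: trig_scale; exact: trig_wave.
Qed.

Lemma chordal_bounds q t : 0 <= chordal q t <= 2 * m%:R.
Proof.
rewrite -[t]reprK chordal_pi; apply/andP; split.
  by apply: sumr_ge0 => j _; rewrite subr_ge0 cos_le1.
rewrite -[X in _ <= 2 * X%:R]card_ord mulr_natr -sumr_const;
  apply: ler_sum => j _.
by have := cos_geN1 (2 * pi * (repr t 0 j - ratr (q 0 j))); lra.
Qed.

Definition chordal_ball q n : set (torus R m) :=
  [set t | chordal q t < n.+1%:R^-1].

Lemma trig_chordal_ball q n : trig_set (chordal_ball q n).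
Proof.
(* The factor is small enough to keep the values of [h] in [0, 1]. *)
pose h t := 1 / 2 + (4 * m.+1%:R)^-1 * (chordal q t + - n.+1%:R^-1).
have M0 : 0 < 4 * m.+1%:R :> R by rewrite mulr_gt0.
have -> : chordal_ball q n = [set t | h t < 1 / 2].
  apply/seteqP; split=> t; rewrite /chordal_ball /h /=;
    by rewrite gtrDl pmulr_rlt0 ?invr_gt0// subr_lt0.
apply: trig_set_sublevel => [|t].
  apply: trig_add; first exact: trig_cst.
  by apply: trig_scale; apply: trig_add;
    [exact: trig_chordal | exact: trig_cst].
have /andP[c0 c1] := chordal_bounds q t.
have n0 : 0 < n.+1%:R^-1 :> R by rewrite invr_gt0.
have n1 : n.+1%:R^-1 <= 1 :> R by rewrite invf_le1// ler1n.
have m1 : 1 <= m.+1%:R :> R by rewrite ler1n.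
rewrite -(natr1 m) in m1 M0 *; rewrite /h.
move: (chordal q t) (n.+1%:R^-1) c0 c1 n0 n1 => y iota c0 c1 n0 n1.
rewrite -(natr1 m); move: (m%:R : R) m1 M0 c1 => M m1 M0 c1.
have IM : (4 * (M + 1))^-1 * (4 * (M + 1)) = 1 by rewrite mulVf ?gt_eqF.
have I0 : 0 < (4 * (M + 1))^-1 by rewrite invr_gt0.
have yl : - (2 * (M + 1)) <= y - iota by lra.
have yu : y - iota <= 2 * (M + 1) by lra.
have := ler_wpM2l (ltW I0) yl; have := ler_wpM2l (ltW I0) yu.
by move: (_^-1) IM => I IM; lra.
Qed.

(** A point at small chordal distance from [q] has, in each coordinate, a
    representative near [q]; all these together form a representative inside a
    ball contained in the preimage of [U]. *)
Lemma torus_open_chordal (U : set (torus R m)) t : open U -> U t ->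
  exists q n, chordal_ball q n t /\ chordal_ball q n `<=` U.
Proof.
move=> oU Ut; pose v := repr t; have p0 := pi_gt0 R.
have : nbhs v (\pi_(torus R m) @^-1` U).
  by apply: open_nbhs_nbhs; split=> //=; rewrite reprK.
move=> /nbhs_ballP[e /= e0 ballU].
pose d : R := Num.min (e / 2) (1 / 4).
have d0 : 0 < d by rewrite lt_min; apply/andP; split; lra.
have de : d <= e / 2 by rewrite /d ge_min lexx.
have d4 : d <= 1 / 4 by rewrite /d ge_min lexx orbT.
have r0 : 0 < 1 - cos (2 * pi * d).
  by rewrite subr_gt0; apply: cos_lt1; nra.
have [n nr] : exists n, n.+1%:R^-1 < 1 - cos (2 * pi * d).
  have [n /= _ /(_ n) H] := near_infty_natSinv_lt (PosNum r0).
  by exists n; apply: H => /=.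
pose rho : R := n.+1%:R^-1 / m.+1%:R.
have rho0 : 0 < rho by rewrite divr_gt0 ?invr_gt0.
have [h h0 hcos] : exists2 h, 0 < h & forall y : R, `|y| < h ->
  1 - cos (2 * pi * y) < rho.
  have : (1 - cos (2 * pi * y)) @[y --> (0 : R)] --> (1 - cos (2 * pi * 0) : R).
    apply: cvgB; first exact: cvg_cst.
    apply: (@cvg_comp _ _ _ (fun y => 2 * pi * y)
      cos _ _ _ _ (@continuous_cos R _)).
    by apply: (@cvgMl_tmp R); exact: cvg_id.
  rewrite mulr0 cos0 subrr => /cvgr_lt/(_ _ rho0)/nbhs_ballP[h /= h0 hb].
  by exists h => // y yh; apply: hb; rewrite /ball /= sub0r normrN.
have [q qP] : exists q : 'rV[rat]_m, forall j,
  `|v 0 j - ratr (q 0 j)| < Num.min h (e / 2).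
  have he : 0 < Num.min h (e / 2) by rewrite lt_min h0; lra.
  have ex j : exists x : rat, `|v 0 j - ratr x| < Num.min h (e / 2).
    have [|x] := @rat_in_itvoo R (v 0 j - Num.min h (e / 2))
      (v 0 j + Num.min h (e / 2)).
      by lra.
    by rewrite in_itv /= => /andP[? ?]; exists x; rewrite ltr_norml;
      apply/andP; split; lra.
  have [f fP] := choice ex; exists (\row_j f j) => j; by rewrite mxE.
exists q, n; split.
  rewrite /chordal_ball /= -[t]reprK chordal_pi -/v.
  apply: (@le_lt_trans _ _ (\sum_(j < m) rho)).
    by apply: ler_sum => j _; apply/ltW/hcos; have := qP j;
      rewrite lt_min => /andP[].
  rewrite sumr_const card_ord -[rho *+ m]mulr_natr /rho mulrAC -mulrA.
  by rewrite gtr_pMr ?invr_gt0// ltr_pdivrMr// mul1r ltr_nat.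
move=> s; rewrite /chordal_ball /= -[s]reprK chordal_pi; set u := repr s => su.
have near_u j : exists z : int, `|u 0 j - ratr (q 0 j) - z%:~R| < d.
  apply: cos_gt_near_int; first by apply/andP; split; lra.
  have : 1 - cos (2 * pi * (u 0 j - ratr (q 0 j))) < 1 - cos (2 * pi * d);
    last by lra.
  apply: le_lt_trans (lt_trans su nr); rewrite (bigD1 j)//= lerDl.
  by apply: sumr_ge0 => l _; rewrite subr_ge0 cos_le1.
have [z zP] := choice near_u.
have -> : \pi_(torus R m) u = \pi_(torus R m) (u - \row_j (z j)%:~R).
  have : u == u - \row_j (z j)%:~R %[mod Quotient.quot (@int_lattice R m)].
    rewrite -Quotient.idealrBE inE opprB addrC subrK.
    by apply/mxOverP => i j; rewrite mxE; apply/intrP; exists (z j).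
  by move/eqP; exact.
apply: ballU; split=> // i j; rewrite ord1 /ball /= !mxE.
have := qP j; rewrite lt_min => /andP[_].
have := zP j; rewrite !ltr_norml => /andP[? ?] /andP[? ?].
by apply/andP; split; lra.
Qed.

Lemma trig_set_generate : @measurable _ (torus R m) = <<s @trig_set R m >>.
Proof.
apply/seteqP; split; last first.
  by apply: smallest_sub; [exact: sigma_algebra_measurable | move=> G []].
apply: smallest_sub; first exact: smallest_sigma_algebra.
move=> U oU; pose I := ('rV[rat]_m * nat)%type.
pose F n : set (torus R m) := if unpickle n is Some i then
  if `[< chordal_ball (i : I).1 i.2 `<=` U >]
    then chordal_ball i.1 i.2 else set0
  else set0.
have -> : U = \bigcup_n F n.
  apply/seteqP; split=> [t Ut|t [n _]].
    have [q [n [qt qU]]] := torus_open_chordal oU Ut.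
    by exists (pickle (q, n)) => //; rewrite /F pickleK asboolT.
  by rewrite /F; case: unpickle => // i; case: asboolP => // iU /iU.
apply: sigma_algebra_bigcup => n; rewrite /F.
case: unpickle => [i|]; last exact: sigma_algebra0.
case: asboolP => _; last exact: sigma_algebra0.
by apply: sub_sigma_algebra; exact: trig_chordal_ball.
Qed.

End trig_sets_generate.

Local Notation pushforward_measure :=
  measure_function_pushforward__canonical__measure_function_Measure.

(** * Fourier coefficients of finite measures on the torus *)

Lemma bounded_integrable d (T : measurableType d) (R : realType)
    (nu : {finite_measure set T -> \bar R}) (u : T -> R) (C : R) :
  measurable_fun setT u -> (forall t, `|u t| <= C) ->
  nu.-integrable setT (EFin \o u).
Proof.
move=> mu uC; apply: (@le_integrable _ _ _ nu setT measurableT _ (fun=> C%:E)).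
- exact/measurable_EFinP.
- move=> t _ /=; rewrite lee_fin; apply: le_trans (uC t) (ler_norm C).
- exact: finite_measure_integrable_cst.
Qed.

Section combination.
Context d d' (T : measurableType d) (T' : measurableType d') (R : realType).
Variables (nu : {finite_measure set T -> \bar R}) (n : nat).
Variables (c : nat -> {nonneg R}).
Variables (nus : nat -> {finite_measure set T' -> \bar R}).
Variables (g : nat -> T' -> T) (mg : forall j, measurable_fun setT (g j)).
Hypothesis nuE : forall G, measurable G ->
  nu G = (\sum_(j < n) ((c j)%:num)%:E * nus j (g j @^-1` G))%E.

Let ge0_integral_combination (u : T -> \bar R) :
  measurable_fun setT u -> (forall t, 0 <= u t)%E ->
  (\int[nu]_t u t = \sum_(j < n) ((c j)%:num)%:E * \int[nus j]_t u (g j t))%E.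
Proof.
move=> mu u0.
pose push j : {measure set T -> \bar R} :=
  pushforward_measure (nus j) (mg j).
pose m j : {measure set T -> \bar R} := mscale (c j) (push j).
rewrite (eq_measure_integral (msum m n)); last first.
  by move=> G mG _; exact: (nuE mG).
rewrite ge0_integral_measure_sum//; apply: eq_bigr => j _.
rewrite ge0_integral_mscale//; congr (_ * _)%E.
exact: ge0_integral_pushforward.
Qed.

(** Integration is additive and homogeneous in the measure for nonnegative
    functions; adding the constant [C] to [u] reduces to this case. *)
Lemma Rintegral_combination (u : T -> R) (C : R) :
  measurable_fun setT u -> (forall t, `|u t| <= C) ->
  (\int[nu]_t u t)%R = \sum_(j < n) (c j)%:num * (\int[nus j]_t u (g j t))%R.
Proof.
move=> mu uC.
have C0 t : 0 <= u t + C.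
  by have := uC t; rewrite ler_norml => /andP[? _]; lra.
have iu := bounded_integrable nu mu uC.
have iug j : (nus j).-integrable setT (EFin \o (u \o g j)).
  apply: (@bounded_integrable _ _ _ _ _ C) => [|t]; last exact: uC.
  exact: measurableT_comp.
have icst d0 (T0 : measurableType d0) (m : {finite_measure set T0 -> \bar R}) :
    m.-integrable setT (EFin \o (fun=> C)).
  exact: finite_measure_integrable_cst.
have shiftE d0 (T0 : measurableType d0)
    (m : {finite_measure set T0 -> \bar R}) v :
    m.-integrable setT (EFin \o v) ->
    (\int[m]_t v t)%R = (\int[m]_t (v t + C))%R - C * fine (m setT).
  move=> iv; rewrite RintegralD//; last exact: icst.
  by rewrite Rintegral_cst// addrK.
have nu_fin d0 (T0 : measurableType d0)
    (m : {finite_measure set T0 -> \bar R}) (B : set T0) :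
    measurable B -> (m B)%E = (fine (m B))%:E.
  by move=> mB; rewrite fineK// fin_num_measure.
rewrite shiftE//; under eq_bigr do rewrite (shiftE _ _ _ (u \o _) (iug _))
  mulrBr.
rewrite sumrB; congr (_ - _).
  have := @ge0_integral_combination (fun t => (u t + C)%:E).
  have muC : measurable_fun setT (fun t => (u t + C)%:E).
    by apply/measurable_EFinP; exact: measurable_funD.
  move=> /(_ muC (fun t => C0 t)) e.
  rewrite /Rintegral e -sum_fine; last first.
    move=> j _; rewrite fin_numM//; apply: integrable_fin_num => //.
    by have := integrableD measurableT (iug j) (icst _ _ (nus j)).
  apply: eq_bigr => j _; rewrite fineM//; apply: integrable_fin_num => //.
  by have := integrableD measurableT (iug j) (icst _ _ (nus j)).
rewrite [X in _ * fine X]nuE//.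
under eq_bigr do rewrite preimage_setT nu_fin// -EFinM.
rewrite sumEFin /= mulr_sumr; apply: eq_bigr => j _; ring.
Qed.

End combination.

Section fourier.
Variables (R : realType) (m : nat).
Implicit Types (k : 'rV[int]_m)
  (nu : {finite_measure set (torus R m) -> \bar R}).

Definition fourier nu k : R[i] :=
  ((\int[nu]_t complex.Re (chi k t))%R +i*
   (\int[nu]_t complex.Im (chi k t))%R)%C.

Lemma Re_chi_measurable (c : R[i]) k :
  measurable_fun setT (fun t : torus R m => complex.Re (c * chi k t)).
Proof. by apply: trig_measurable; exact: trig_wave. Qed.

Lemma trig_bounded (f : torus R m -> R) : trig_poly f ->
  exists C, forall t, `|f t| <= C.
Proof.
elim=> [c k|{}f g _ [C fC] _ [D gD]].
  exists (`|complex.Re c| + `|complex.Im c|) => t.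
  rewrite -[t]reprK Re_chi_pi; apply: le_trans (ler_normB _ _) _.
  rewrite !normrM; apply: lerD; rewrite ler_piMr//.
  - by rewrite ler_norml cos_geN1 cos_le1.
  - by rewrite ler_norml sin_geN1 sin_le1.
by exists (C + D) => t; apply: le_trans (ler_normD _ _) _; apply: lerD.
Qed.

Lemma trig_integrable nu (f : torus R m -> R) : trig_poly f ->
  nu.-integrable setT (EFin \o f).
Proof.
move=> tf; have [C fC] := trig_bounded tf.
exact: bounded_integrable (trig_measurable tf) fC.
Qed.

Lemma trig_Re k : trig_poly (fun t : torus R m => complex.Re (chi k t)).
Proof. by under eq_fun do rewrite -[chi _ _]mul1r; exact: trig_wave. Qed.

Lemma trig_Im k : trig_poly (fun t : torus R m => complex.Im (chi k t)).
Proof.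
rewrite (_ : (fun t => _) = fun t => complex.Re ((0 -i* 1)%C * chi k t)).
  exact: trig_wave.
by apply/funext => t; case: (chi k t) => a b /=;
  rewrite mul0r mulN1r sub0r opprK.
Qed.

Lemma ReM (a b : R[i]) :
  complex.Re (a * b) = complex.Re a * complex.Re b -
    complex.Im a * complex.Im b.
Proof. by case: a; case: b. Qed.

Lemma ImM (a b : R[i]) :
  complex.Im (a * b) = complex.Re a * complex.Im b +
    complex.Im a * complex.Re b.
Proof. by case: a; case: b => ? ? ? ? /=; rewrite addrC; congr (_ + _). Qed.

Lemma Re_scale (a : R) (b : R[i]) : complex.Re (a%:C%C * b) = a * complex.Re b.
Proof. by rewrite ReM mul0r subr0. Qed.

Lemma Im_scale (a : R) (b : R[i]) : complex.Im (a%:C%C * b) = a * complex.Im b.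
Proof. by rewrite ImM mul0r addr0. Qed.

Lemma Rintegral_Re_chi nu c k :
  (\int[nu]_t complex.Re (c * chi k t))%R = complex.Re (c * fourier nu k).
Proof.
under eq_Rintegral do rewrite ReM.
have scale a f : trig_poly f ->
  trig_poly (fun t : torus R m => a * f t) by exact: trig_scale.
rewrite RintegralB//; last 2 first.
- by apply: trig_integrable; apply: scale; exact: trig_Re.
- by apply: trig_integrable; apply: scale; exact: trig_Im.
rewrite !RintegralZl// ?ReM//; apply: trig_integrable;
  [exact: trig_Im | exact: trig_Re].
Qed.

Lemma Rintegral_Im_chi nu c k :
  (\int[nu]_t complex.Im (c * chi k t))%R = complex.Im (c * fourier nu k).
Proof.
under eq_Rintegral do rewrite ImM.
have scale a f : trig_poly f ->
  trig_poly (fun t : torus R m => a * f t) by exact: trig_scale.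
rewrite RintegralD//; last 2 first.
- by apply: trig_integrable; apply: scale; exact: trig_Im.
- by apply: trig_integrable; apply: scale; exact: trig_Re.
rewrite !RintegralZl// ?ImM//; apply: trig_integrable;
  [exact: trig_Re | exact: trig_Im].
Qed.

Lemma Re_chi_le1 k t : `|complex.Re (chi k t)| <= 1 :> R.
Proof. by rewrite /chi /e2pi /= ler_norml cos_geN1 cos_le1. Qed.

Lemma Im_chi_le1 k t : `|complex.Im (chi k t)| <= 1 :> R.
Proof. by rewrite /chi /e2pi /= ler_norml sin_geN1 sin_le1. Qed.

(** Translating a measure by [s] multiplies its [k]-th coefficient by
    [chi k s], as [chi k] is a character. *)
Lemma fourier_combination nu n (c : 'I_n.+1 -> R)
    (nus : 'I_n.+1 -> {finite_measure set (torus R m) -> \bar R})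
    (s : 'I_n.+1 -> torus R m) :
    (forall j, 0 <= c j) ->
    (forall G, measurable G ->
      nu G = (\sum_j (c j)%:E * nus j [set t | G (t + s j)%R])%E) ->
  forall k,
    fourier nu k = \sum_j (c j)%:C%C * (chi k (s j) * fourier (nus j) k).
Proof.
move=> c0 nuE k.
have comb (u : torus R m -> R) : measurable_fun setT u ->
    (forall t, `|u t| <= 1) ->
    (\int[nu]_t u t)%R = \sum_j c j * (\int[nus j]_t u (t + s j))%R.
  move=> mu u1.
  rewrite (@Rintegral_combination _ _ _ _ _ nu n.+1
    (fun j => NngNum (c0 (inord j))) (fun j => nus (inord j))
    (fun j t => t + s (inord j)) _ _ u 1)//.
  - by apply: eq_bigr => j _; rewrite inord_val.
  - by move=> j; exact: torus_translation_measurable.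
  - by move=> G mG; rewrite nuE//; apply: eq_bigr => j _; rewrite inord_val.
apply/eqP; rewrite eq_complex; apply/andP; split; apply/eqP.
  rewrite [LHS]comb; [|exact: trig_measurable (trig_Re k)|exact: Re_chi_le1].
  rewrite raddf_sum; apply: eq_bigr => j _.
  rewrite -[RHS]/(complex.Re _) Re_scale -Rintegral_Re_chi; congr (_ * _).
  by apply: eq_Rintegral => t _; rewrite chiD mulrC.
rewrite [LHS]comb; [|exact: trig_measurable (trig_Im k)|exact: Im_chi_le1].
rewrite raddf_sum; apply: eq_bigr => j _.
rewrite -[RHS]/(complex.Im _) Im_scale -Rintegral_Im_chi; congr (_ * _).
by apply: eq_Rintegral => t _; rewrite chiD mulrC.
Qed.

Lemma fourier0 nu : fourier nu 0 = (fine (nu setT))%:C%C.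
Proof.
rewrite /fourier; under eq_Rintegral do rewrite chi0.
under [X in (_ +i* X)%C]eq_Rintegral do rewrite chi0.
by rewrite !Rintegral_cst//= mul1r mul0r.
Qed.

Lemma fourier_trig nu1 nu2 (f : torus R m -> R) :
    (forall k, fourier nu1 k = fourier nu2 k) -> trig_poly f ->
  (\int[nu1]_t f t)%R = (\int[nu2]_t f t)%R.
Proof.
move=> e; elim=> [c k|{}f g tf IHf tg IHg];
  first by rewrite !Rintegral_Re_chi e.
by rewrite !RintegralD ?IHf ?IHg//; exact: trig_integrable.
Qed.

Lemma cvg_integral_trig_set nu G (u : nat -> torus R m -> R) :
    measurable G -> (forall n, trig_poly (u n)) ->
    (forall n t, 0 <= u n t <= 1) ->
    (forall t, u n t @[n --> \oo] --> (\1_G t : R)) ->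
  (\int[nu]_t u n t)%R @[n --> \oo] --> fine (nu G).
Proof.
move=> mG tu u01 uG.
have [] := @dominated_convergence _ _ _ nu setT measurableT
  (fun n t => (u n t)%:E) (fun t => (\1_G t)%:E) (fun=> 1%:E).
- by move=> n; apply/measurable_EFinP; exact: trig_measurable.
- by apply/measurable_EFinP; exact: measurable_indic.
- by apply: aeW => t _; apply: cvg_EFin; [exact: nearW | exact: uG].
- exact: finite_measure_integrable_cst.
- apply: aeW => t n _; rewrite /= lee_fin.
  by case/andP: (u01 n t) => ? ?; rewrite ger0_norm.
move=> _ _; rewrite integral_indic// setIT => lim.
apply: fine_cvg; rewrite fineK ?fin_num_measure//.
Qed.

(** Equal coefficients give equal integrals of trigonometric polynomials, and by
    dominated convergence equal values on the sets of [trig_set], which are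
    closed under intersection and generate the Borel sets. *)
Lemma fourier_inj nu1 nu2 : (forall k, fourier nu1 k = fourier nu2 k) ->
  forall G, measurable G -> nu1 G = nu2 G.
Proof.
move=> e; apply: (measure_unique (@trig_set R m) (fun=> setT)).
- exact: trig_set_generate.
- exact: trig_setI.
- by move=> _; exact: trig_setT.
- by apply/seteqP; split=> // t _; exists 0%N.
- move=> G [mG [u [tu u01 uG]]].
  have l1 := cvg_integral_trig_set (nu := nu1) mG tu u01 uG.
  have l2 := cvg_integral_trig_set (nu := nu2) mG tu u01 uG.
  have e12 : fine (nu1 G) = fine (nu2 G).
    have int12 : (fun n => \int[nu1]_t u n t)%R =
      (fun n => \int[nu2]_t u n t)%R.
      by apply/funext => n; exact: fourier_trig.
    by rewrite int12 in l1; exact: cvg_unique l1 l2.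
  by rewrite -[LHS]fineK ?fin_num_measure// -[RHS]fineK ?fin_num_measure// e12.
- by move=> _; rewrite ltey_eq fin_num_measure.
Qed.

End fourier.

Lemma chi_minus1 (R : realType) (m : nat) (k : 'rV[int]_m) : k != 0 ->
  exists s : torus R m, chi k s = -1.
Proof.
move=> /rV0Pn[j kj].
exists (\pi_(torus R m) (\row_l if l == j then ((k 0 j)%:~R * 2)^-1 else 0)).
rewrite /chi pairing_pi e2pi_pi (bigD1 j)//= mxE eqxx big1 ?addr0; last first.
  by move=> l lj; rewrite mxE (negbTE lj) mulr0.
have -> : 2 * pi * ((k 0 j)%:~R * ((k 0 j)%:~R * 2)^-1) = pi :> R.
  by field; rewrite intr_eq0.
by rewrite cospi sinpi; apply/eqP; rewrite eq_complex /= oppr0 !eqxx.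
Qed.

(** A translation by [s] with [chi k s = -1] preserves [Leb] and changes the
    sign of the coefficient. *)
Lemma haar_fourier (R : realType) (m : nat) (Leb : probability (torus R m) R)
    k :
  haar_probability Leb -> k != 0 -> fourier Leb k = 0.
Proof.
move=> haar k0; have [s sE] := chi_minus1 R k0.
have := @fourier_combination R m Leb 0 (fun=> 1) (fun=> Leb) (fun=> s)
  (fun=> ler01).
move=> /(_ _ k); rewrite big_ord1 sE mul1r mulN1r => fE.
have : fourier Leb k *+ 2 == 0.
  rewrite mulr2n {1}fE ?addNr// => G mG; rewrite big_ord1 mul1e.
  exact/esym/haar.
by rewrite mulrn_eq0 /= => /eqP.
Qed.

(** * Measurable sets of the shift space and of the skew product *)

Section shift_space_sets.
Variable N : nat.
Implicit Types (w : shift_space N) (n : nat).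

Lemma cylinder_measurable n w : measurable (cylinder n w).
Proof. by apply: sub_sigma_algebra; exists n, w. Qed.

Lemma cylinder_setI n w n' w' :
  cylinder n w `&` cylinder n' w' = set0 \/
  exists n'' w'', cylinder n w `&` cylinder n' w' = cylinder n'' w''.
Proof.
case: (pselect (exists x, (cylinder n w `&` cylinder n' w') x)); last first.
  move=> no; left; apply/seteqP; split=> // x xI; apply: no; by exists x.
move=> [x [xw xw']]; right; exists (maxn n n'), x.
apply/seteqP; split=> y.
  move=> [yw yw'] r; rewrite leq_max => /orP[rn|rn].
    by rewrite yw ?xw.
  by rewrite yw' ?xw'.
move=> yx; split=> r rn.
  by rewrite yx ?xw// leq_max rn.
by rewrite yx ?xw'// leq_max rn orbT.
Qed.

Definition shift_cons (i : 'I_N.+1) w : shift_space N :=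
  fun n => if n is n'.+1 then w n' else i.

Definition letter r (i : 'I_N.+1) : set (shift_space N) := [set x | x r = i].

Lemma letter0 i : letter 0 i = cylinder 0 (fun=> i).
Proof.
by apply/seteqP; split=> [x xi r|x]; [rewrite leqn0 => /eqP -> | exact].
Qed.

Lemma shift_measurable : measurable_fun setT (@Defs.shift N).
Proof.
apply: (measurability (@cylinders N)) => // _ [_ [n [w ->]] <-].
rewrite setTI (_ : _ @^-1` _ = \bigcup_i cylinder n.+1 (shift_cons i w)).
  by apply: fin_bigcup_measurable => // i _; exact: cylinder_measurable.
apply/seteqP; split=> [x xw|x [i _ xw] r rn];
  last by rewrite -[RHS]/(shift_cons i w r.+1) -xw.
by exists (x 0%N) => // -[|r]// rn; exact: xw.
Qed.

Lemma letter_measurable r i : measurable (letter r i).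
Proof.
elim: r => [|r IHr]; first by rewrite letter0; exact: cylinder_measurable.
rewrite (_ : letter _ _ = setT `&` @Defs.shift N @^-1` letter r i);
  last by rewrite setTI.
exact: shift_measurable.
Qed.

End shift_space_sets.

Section product_sets.
Variables (R : realType) (N m : nat).
Local Notation T := (shift_space N * torus R m)%type.

Let boxes := [set E : set T | exists C B,
  [/\ C = set0 \/ cylinders C, measurable B & E = C `*` B]].

Let fst_measurable : measurable_fun setT (fst : g_sigma_algebraType boxes ->
  shift_space N).
Proof.
apply: (measurability (@cylinders N)) => // _ [C cC <-].
rewrite setTI; apply: sub_sigma_algebra; exists C, setT; split=> //;
  first by right.
by apply/seteqP; split=> // x [].
Qed.

Let snd_measurable : measurable_fun setT (snd : g_sigma_algebraType boxes ->
  torus R m).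
Proof.
move=> _ B mB; rewrite setTI.
rewrite (_ : _ @^-1` _ = \bigcup_i (cylinder 0 (fun=> i : 'I_N.+1) `*` B)).
  apply: fin_bigcup_measurable => // i _; apply: sub_sigma_algebra.
  by exists (cylinder 0 (fun=> i)), B; split=> //; right; exists 0%N, (fun=> i).
apply/seteqP; split=> [[x t] Bt|[x t] [i _ []]//].
by exists (x 0%N) => //; split=> // r; rewrite leqn0 => /eqP ->.
Qed.

(** Boxes over a cylinder, together with the empty set, are stable under
    intersection and generate; the finitely many boxes over a single letter
    cover the space. *)
Lemma prod_measure_unique (m1 m2 : {measure set T -> \bar R}) :
    (m1 setT < +oo)%E ->
    (forall n w B, measurable B ->
      m1 (cylinder n w `*` B) = m2 (cylinder n w `*` B)) ->
  forall E, measurable E -> m1 E = m2 E.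
Proof.
move=> m1_fin m12.
pose g k : set T := if (k <= N)%N then cylinder 0 (fun=> inord k)
  `*` setT else set0.
apply: (measure_unique boxes g).
- apply/seteqP; split; last first.
    apply: smallest_sub; first exact: sigma_algebra_measurable.
    move=> _ [C [B [[->|[n [w ->]]] mB ->]]]; first by rewrite set0X.
    by apply: measurableX => //; exact: cylinder_measurable.
  rewrite measurable_prod_measurableType.
  apply: smallest_sub; first exact: smallest_sigma_algebra.
  move=> _ [C mC [B mB <-]].
  have := measurableI _ _ (fst_measurable measurableT mC)
    (snd_measurable measurableT mB).
  by rewrite !setTI.
- move=> _ _ [C [B [cC mB ->]]] [C' [B' [cC' mB' ->]]].
  exists (C `&` C'), (B `&` B'); split; last by rewrite setXI.
    case: cC cC' => [->|[n [w ->]]]; first by left; rewrite set0I.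
    case=> [->|[n' [w' ->]]]; first by left; rewrite setI0.
    by case: (cylinder_setI n w n' w') => [|[n'' [w'' ->]]]; [left | right;
      exists n'', w''].
  exact: measurableI.
- move=> k; rewrite /g; case: ifP => _.
    by exists (cylinder 0 (fun=> inord k)), setT; split=> //; right;
      exists 0%N, (fun=> inord k).
  by exists set0, setT; split=> //; [left | rewrite set0X].
- apply/seteqP; split=> // -[x t] _; exists (x 0%N : nat) => //.
  rewrite /g -ltnS ltn_ord; split=> // r; rewrite leqn0 => /eqP ->.
  by rewrite inord_val.
- move=> _ [C [B [[->|[n [w ->]]] mB ->]]]; first by rewrite set0X !measure0.
  exact: m12.
- move=> k; apply: le_lt_trans m1_fin; apply: le_measure; rewrite ?inE//.
  rewrite /g; case: ifP => // _.
  by apply: measurableX => //; exact: cylinder_measurable.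
Qed.

Lemma skew_product_measurable (theta : 'I_N.+1 -> torus R m) :
  measurable_fun setT (skew_product theta).
Proof.
apply: measurable_fun_pair.
  exact: (measurableT_comp (@shift_measurable N) measurable_fst).
move=> _ B mB; rewrite setTI.
rewrite (_ : _ @^-1` _ = \bigcup_i (letter 0 i `*` [set t | B (t + theta i)])).
  apply: fin_bigcup_measurable => // i _; apply: measurableX.
    exact: letter_measurable.
  by rewrite -[X in measurable X]setTI; exact: torus_translation_measurable.
apply/seteqP; split=> [[x t] /= Bt|[x t] [i _ [/= <-]]//].
by exists (x 0%N).
Qed.

End product_sets.

(** * The Markov property of the skew product *)

Section slice.
Context d1 d2 (T1 : measurableType d1) (T2 : measurableType d2) (R : realType).
Variable M : {finite_measure set (T1 * T2)%type -> \bar R}.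

(** The second marginal of the restriction of [M] to [A]. *)
Definition slice A (mA : measurable A) : set T2 -> \bar R :=
  pushforward (mrestr M mA) snd.

HB.instance Definition _ A (mA : measurable A) := Measure.copy (slice mA)
  (pushforward_measure (mrestr M mA) measurable_snd).

Let slice_fin A (mA : measurable A) : fin_num_fun (slice mA).
Proof.
move=> B mB; apply: fin_num_measure.
by rewrite -[X in measurable X]setTI; exact: measurable_snd.
Qed.

HB.instance Definition _ A (mA : measurable A) :=
  @Measure_isFinite.Build _ _ _ (slice mA) (slice_fin mA).

End slice.

Section markov.
Variables (R : realType) (N m : nat) (P : 'M[R]_N.+1).
Hypotheses (P_stochastic : stochastic P) (P_irreducible : irreducible P).
Variables (p : 'rV[R]_N.+1).
Hypothesis p_stationary : stationary P p.
Variables (mu : probability (shift_space N) R)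
  (Leb : probability (torus R m) R).
Hypotheses (mu_markov : markov_measure P p mu)
  (Leb_haar : haar_probability Leb).
Variable theta : 'I_N.+1 -> torus R m.
Local Notation T := (shift_space N * torus R m)%type.
Local Notation F := (skew_product theta).

Let M : probability T R := (mu \x Leb)%E.

Lemma product_box C B : measurable C -> measurable B ->
  M (C `*` B) = (mu C * Leb B)%E.
Proof. by move=> mC mB; exact: product_measure1E. Qed.

(** The transition probability of the reversed chain, from [j] back to [i]. *)
Definition backward i j : R := p 0 i * P i j / p 0 j.

Let p_gt0 := stationary_gt0 P_stochastic P_irreducible p_stationary.

Lemma backward_ge0 i j : 0 <= backward i j.
Proof.
by rewrite /backward !mulr_ge0 ?invr_ge0 ?(ltW (p_gt0 _))//; apply P_stochastic.
Qed.

Lemma letter_box_measurable j : measurable (letter 0 j `*` setT : set T).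
Proof. by apply: measurableX => //; exact: letter_measurable. Qed.

Lemma letters_box_measurable i j :
  measurable ((letter 0 i `&` letter 1 j) `*` setT : set T).
Proof.
by apply: measurableX => //; apply: measurableI; exact: letter_measurable.
Qed.

Lemma translate_measurable (s : torus R m) B : measurable B ->
  measurable [set t | B (t + s)].
Proof.
by move=> mB; rewrite -[X in measurable X]setTI;
  exact: torus_translation_measurable.
Qed.

Lemma mu_shift_cons n i w : (mu (cylinder n.+1 (shift_cons i w)) =
  (backward i (w 0%N))%:E * mu (cylinder n w))%E.
Proof.
rewrite !mu_markov big_ord_recl /= -EFinM; congr (_%:E).
by rewrite /backward; field; rewrite gt_eqF.
Qed.

(** By the Markov property, [F] pushes the restriction of the measure to
    [x_0 = i], [x_1 = j] onto a multiple of its restriction to [x_0 = j]: the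
    translation of the torus is absorbed by the invariance of [Leb].  Both
    sides are measures in [E], so products of a cylinder and a Borel set
    suffice. *)
Lemma markov_step i j E : measurable E ->
  (M (F @^-1` E `&` (letter 0 i `&` letter 1 j) `*` setT) =
   (backward i j)%:E * M (E `&` letter 0 j `*` setT))%E.
Proof.
pose m1 := pushforward_measure
  (mrestr M (letters_box_measurable i j)) (skew_product_measurable theta).
pose m2 : {measure set T -> \bar R} :=
  mscale (NngNum (backward_ge0 i j)) (mrestr M (letter_box_measurable j)).
suff m12 E' : measurable E' -> m1 E' = m2 E' by move=> mE; exact: m12.
have m1E A : m1 A = M (F @^-1` A `&` (letter 0 i `&` letter 1 j) `*` setT)
  by [].
have m2E A : m2 A = ((backward i j)%:E * M (A `&` letter 0 j `*` setT))%E by [].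
apply: prod_measure_unique => [|n w B mB].
  rewrite m1E preimage_setT setTI; apply: le_lt_trans (probability_le1 M _) _.
    exact: letters_box_measurable.
  exact: ltry.
rewrite m1E m2E.
case: (eqVneq (w 0%N) j) => [wj|wj]; last first.
  have -> : F @^-1` (cylinder n w `*` B) `&` (letter 0 i `&` letter 1 j)
    `*` setT = set0.
    apply/seteqP; split=> // -[x t] [[/= xw _] [[_ xj] _]].
    by move: wj; rewrite -(xw 0%N)// -[Defs.shift x 0%N]/(x 1%N) xj eqxx.
  have -> : cylinder n w `*` B `&` letter 0 j `*` setT = set0 :> set T.
    apply/seteqP; split=> // -[x t] [[/= xw _] [xj _]].
    by move: wj; rewrite -(xw 0%N)// xj eqxx.
  by rewrite !measure0 mule0.
have -> : F @^-1` (cylinder n w `*` B) `&` (letter 0 i `&` letter 1 j)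
  `*` setT =
    cylinder n.+1 (shift_cons i w) `*` [set t | B (t + theta i)].
  apply/seteqP; split=> [[x t] [[/= xw Bt] [[xi _] _]]|[x t] [/= xw Bt]].
    split=> /=; last by move: Bt; rewrite xi.
    by case=> [|r] // rn; exact: xw.
  have xi : x 0%N = i by rewrite xw.
  have xj : x 1%N = j by rewrite -wj; exact: (xw 1%N).
  split; last by [].
  by split=> [r rn|] /=; [exact: (xw r.+1) | rewrite xi].
have -> : cylinder n w `*` B `&` letter 0 j `*` setT =
  cylinder n w `*` B :> set T.
  apply/seteqP; split=> [[x t] []//|[x t] [/= xw Bt]].
  by split=> //; split=> //; rewrite -wj; exact: xw.
rewrite !product_box ?mu_shift_cons ?wj ?muleA//.
- by congr (_ * _)%E; exact: Leb_haar.
- exact: cylinder_measurable.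
- exact: cylinder_measurable.
- exact: translate_measurable.
Qed.

Lemma letter_sum (f : {measure set T -> \bar R}) r E : measurable E ->
  f E = (\sum_i f (E `&` letter r i `*` setT))%E.
Proof.
move=> mE; rewrite fsbig_seq ?index_enum_uniq//.
have -> : [set` index_enum 'I_N.+1] = setT.
  by apply/seteqP; split=> // i _ /=; rewrite mem_index_enum.
rewrite -measure_fin_bigcup//.
- congr (f _); apply/seteqP; split=> [[x t] Ex|[x t] [i _ []]//].
  by exists (x r).
- exact: finite_finset.
- by move=> i j _ _ [[x t] [[_ [/= <- _]] [_ [/= <- _]]]].
- move=> i _; apply: measurableI => //; apply: measurableX => //.
  exact: letter_measurable.
Qed.

Lemma backward_sum j : \sum_i backward i j = 1.
Proof.
rewrite -mulr_suml; have [_ _ /rowP/(_ j)] := p_stationary.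
by rewrite mxE => ->; rewrite mulfV// gt_eqF.
Qed.

Lemma skew_product_preserves A : measurable A -> M (F @^-1` A) = M A.
Proof.
move=> mA.
have mFA : measurable (F @^-1` A).
  by rewrite -[X in measurable X]setTI; exact: skew_product_measurable.
rewrite (letter_sum M 0 mFA) (letter_sum M 0 mA).
transitivity (\sum_i \sum_j (backward i j)%:E * M (A `&`
    letter 0 j `*` setT))%E.
  apply: eq_bigr => i _; rewrite (letter_sum M 1); last first.
    by apply: measurableI => //; exact: letter_box_measurable.
  apply: eq_bigr => j _; rewrite -markov_step//; congr (M _).
  by apply/seteqP; split=> [[x t] [[Ax [xi _]] [xj _]]|[x t] [Ax [[xi xj] _]]].
rewrite exchange_big; apply: eq_bigr => j _ /=.
rewrite -ge0_sume_distrl; last by move=> i _; rewrite lee_fin backward_ge0.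
by rewrite sumEFin backward_sum mul1e.
Qed.

(** * The spectral condition implies ergodicity *)

Section invariant_set.
Variable A : set T.
Hypotheses (mA : measurable A) (A_invariant : F @^-1` A = A).

(** As [A] is its own preimage, [markov_step] applied to the intersection of [A]
    with a box has again the intersection of [A] with a box on its left-hand
    side. *)
Lemma invariant_step i j C B : measurable C -> measurable B ->
  (M (A `&` (letter 0 i `&` letter 1 j `&` @Defs.shift N @^-1` C) `*` B) =
   (backward i j)%:E * M (A `&` (C `&` letter 0 j) `*`
     [set t | B (t - theta i)%R]))%E.
Proof.
move=> mC mB; pose E : set T := A `&` C `*` [set t | B (t - theta i)].
have mE : measurable E.
  by apply: measurableI => //; apply: measurableX => //;
    exact: translate_measurable.
have invA z : A (F z) = A z by rewrite -[in RHS]A_invariant.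
have := markov_step i j mE;
  rewrite (_ : E `&` _ = A `&` (C `&` letter 0 j) `*`
    [set t | B (t - theta i)]).
  move=> <-; congr (M _).
  apply/seteqP; split=> [[x t] [Axt [[[xi xj] xC] Bt]]|[x t] [[Axt [xC Bt]]
    [[xi xj] _]]].
    have {}xi : x 0%N = i := xi.
    by split=> //; split; [rewrite invA | split=> //; rewrite /= xi addrK].
  have {}xi : x 0%N = i := xi; split; first by rewrite -invA.
  by split=> //; move: Bt; rewrite /= xi addrK.
by apply/seteqP; split=> [[x t] [[Axt [xC Bt]] [xj _]]|[x t] [Axt [[xC xj]
  Bt]]].
Qed.

Let mletter i : measurable (A `&` letter 0 i `*` setT).
Proof. by apply: measurableI => //; exact: letter_box_measurable. Qed.

Let nu i : {finite_measure set (torus R m) -> \bar R} := slice M (mletter i).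

Let nuE i B : nu i B = M (A `&` letter 0 i `*` B).
Proof.
by congr (M _); apply/seteqP;
  split=> [[x t] [/= Bt [Axt [xi _]]]|[x t] [Axt [xi Bt]]].
Qed.

(** By [invariant_step] summed over the second letter, [nu i] is the mixture
    with weights [backward i j] of the translates of [nu j] by [- theta i];
    dividing by [p 0 i] turns these weights into [P i j]. *)
Lemma fourier_slice_fixed k i :
  fourier (nu i) k / (p 0 i)%:C%C =
  chi (- k) (theta i) * \sum_j (P i j)%:C%C * (fourier (nu j) k / (p 0 j)%:C%C).
Proof.
have p_neq0 j : (p 0 j)%:C%C != 0 :> R[i] by rewrite fmorph_eq0 gt_eqF.
rewrite (@fourier_combination _ _ _ _ (backward i) nu (fun=> - theta i));
  first last.
- move=> B mB; rewrite nuE.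
  rewrite (letter_sum M 1); last first.
    by apply: measurableI => //; apply: measurableX => //;
      exact: letter_measurable.
  apply: eq_bigr => j _; rewrite nuE.
  have := invariant_step i j measurableT mB; rewrite setTI => <-; congr (M _).
  by apply/seteqP; split=> [[x t] [[Axt [xi Bt]] [xj _]]|[x t] [Axt [[[xi xj]
    _] Bt]]].
- exact: backward_ge0.
rewrite chi_opp mulr_suml mulr_sumr; apply: eq_bigr => j _.
by rewrite /backward !rmorphM fmorphV /=; field; rewrite !p_neq0.
Qed.

Hypothesis spectral : forall k : 'rV[int]_m, k != 0 ->
  ~~ eigenvalue (twist theta k *m map_mx (real_complex R) P) 1.

Lemma fourier_slice_eq0 k i : k != 0 -> fourier (nu i) k = 0.
Proof.
move=> k0; pose v : 'cV[R[i]]_N.+1 := \col_i (fourier (nu i) k / (p 0 i)%:C%C).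
have v0 : v = 0.
  apply/eqP; apply: contraT => vN0.
  have Nk0 : - k != 0 by rewrite oppr_eq0.
  have /negP := spectral Nk0; case; apply/eigenvalue1_fixed; exists v => //.
  apply/twist_fixedE => j; rewrite mxE fourier_slice_fixed; congr (_ * _).
  by apply: eq_bigr => l _; rewrite mxE.
have /eqP := congr1 (fun u : 'cV_N.+1 => u i 0) v0.
rewrite !mxE mulf_eq0 invr_eq0 fmorph_eq0 [p 0 i == 0]gt_eqF ?orbF//.
by move/eqP.
Qed.

(** The masses are the coefficients at [k = 0], where the fixed vector is
    untwisted and therefore constant. *)
Lemma invariant_letter_mass i :
  (M (A `&` letter 0 i `*` setT) = M A * (p 0 i)%:E)%E.
Proof.
pose v i := fourier (nu i) 0 / (p 0 i)%:C%C.
have vfix a : v a = 1 * \sum_j (P a j)%:C%C * v j.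
  by rewrite {1}/v fourier_slice_fixed oppr0 chi0.
have edge a b : 0 < P a b -> v a = v b.
  move=> Pab; rewrite -[RHS]mul1r.
  apply: (twisted_fixed_edge P_stochastic P_irreducible p_stationary
    (eps := fun=> 1)) => //.
  by move=> _; rewrite mul1r rmorph1.
have vconst j : v j = v i.
  apply: (walk_invariant P_stochastic P_irreducible
    (Q := fun j => v j = v i) _ (erefl (v i))).
  by move=> a b /edge <-.
have nu_mass j : fourier (nu j) 0 = v i * (p 0 j)%:C%C.
  by rewrite -(vconst j) /v mulfVK// fmorph_eq0 gt_eqF.
have M_fin B : measurable B -> M B = (fine (M B))%:E.
  by move=> mB; rewrite fineK// fin_num_measure.
have tot : (fine (M A))%:C%C = v i.
  rewrite (letter_sum M 0 mA) -sum_fine; last by move=> j _;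
    exact: fin_num_measure.
  rewrite rmorph_sum /= (eq_bigr (fun j => v i * (p 0 j)%:C%C)); last first.
    by move=> j _; rewrite -nu_mass fourier0 nuE.
  rewrite -mulr_sumr -rmorph_sum; have [_ -> _] := p_stationary.
  by rewrite mulr1.
have := nu_mass i; rewrite fourier0 nuE -tot -rmorphM => -[e].
by rewrite M_fin// e (M_fin A)// EFinM.
Qed.

Lemma invariant_letter_box i B : measurable B ->
  (M (A `&` letter 0 i `*` B) = M A * ((p 0 i)%:E * Leb B))%E.
Proof.
have MAp : 0 <= fine (M A) * p 0 i.
  by rewrite mulr_ge0 ?fine_ge0// ltW.
have MA : M A = (fine (M A))%:E by rewrite fineK// fin_num_measure.
pose nu' : {finite_measure set (torus R m) -> \bar R} :=
  mscale (NngNum MAp) Leb.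
have nu'E B' : nu' B' = (M A * ((p 0 i)%:E * Leb B'))%E.
  by rewrite muleA {1}MA -EFinM.
move=> mB; rewrite -nuE -nu'E; apply: fourier_inj => // k.
have [->|k0] := eqVneq k 0.
  rewrite !fourier0 nuE nu'E; congr (_%:C)%C; congr fine.
  by rewrite invariant_letter_mass probability_setT mule1.
rewrite fourier_slice_eq0//.
rewrite (@fourier_combination _ _ _ 0 (fun=> fine (M A) * p 0 i) (fun=> Leb)
  (fun=> 0)) => //.
  by rewrite big_ord1 (haar_fourier Leb_haar k0) !mulr0.
move=> G mG; rewrite big_ord1; congr (_ * Leb _)%E.
by apply/seteqP; split=> t; rewrite /= addr0.
Qed.

Lemma invariant_cylinder_box n w B : measurable B ->
  (M (A `&` cylinder n w `*` B) = M A * (mu (cylinder n w) * Leb B))%E.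
Proof.
elim: n w B => [|n IHn] w B mB.
  have -> : cylinder 0 w = letter 0 (w 0%N).
    by apply/seteqP; split=> [x xw|x xw r];
      [exact: (xw 0%N) | rewrite leqn0 => /eqP ->].
  rewrite invariant_letter_box// letter0 mu_markov big_ord0 mulr1//.
pose w' : shift_space N := Defs.shift w.
have -> : cylinder n.+1 w = cylinder n.+1 (shift_cons (w 0%N) w').
  by apply/seteqP; split=> x xw r rn; rewrite xw//; case: r {rn}.
rewrite mu_shift_cons.
transitivity (M (A `&` (letter 0 (w 0%N) `&` letter 1 (w' 0%N)
  `&` @Defs.shift N @^-1` cylinder n w') `*` B)).
  congr (M _); apply/seteqP;
    split=> [[x t] [Axt [xw Bt]]|[x t] [Axt [[[xi xj] xw] Bt]]].
    split=> //; split=> //; split; first by split;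
      [exact: (xw 0%N) | exact: (xw 1%N)].
    by move=> r rn; exact: (xw r.+1).
  by split=> //; split=> // -[|r] rn; [exact: xi | exact: xw].
rewrite invariant_step//; last exact: cylinder_measurable.
have -> : cylinder n w' `&` letter 0 (w' 0%N) = cylinder n w'.
  by apply/seteqP; split=> [x []//|x xw]; split=> //; exact: (xw 0%N).
rewrite IHn; last exact: translate_measurable.
have -> : Leb [set t | B (t - theta (w 0%N))%R] = Leb B by exact: Leb_haar.
by rewrite muleCA -muleA.
Qed.

(** An invariant set is independent of every set, hence of itself. *)
Lemma invariant_measure01 : M A = 0%E \/ M (~` A) = 0%E.
Proof.
have MA : M A = (fine (M A))%:E by rewrite fineK// fin_num_measure.
have MA0 : 0 <= fine (M A) by rewrite fine_ge0.
pose m1 : {measure set T -> \bar R} := mrestr M mA.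
pose m2 : {measure set T -> \bar R} := mscale (NngNum MA0) M.
have m1E B : m1 B = M (B `&` A) by [].
have m2E B : m2 B = (M A * M B)%E by rewrite {1}MA.
have m12 : m1 A = m2 A.
  apply: prod_measure_unique => // [|n w B mB].
    rewrite m1E; apply: le_lt_trans (probability_le1 M _) (ltry _).
    exact: measurableI.
  rewrite m1E m2E setIC invariant_cylinder_box// product_box//.
  exact: cylinder_measurable.
move: m12; rewrite m1E m2E setIid MA -EFinM => -[/eqP].
rewrite -[X in X == _]mulr1 -subr_eq0 -mulrBr mulf_eq0 subr_eq0.
case/orP => [/eqP ->|/eqP MA1]; first by left.
by right; rewrite probability_setC// MA -MA1 subee.
Qed.

End invariant_set.

Lemma spectral_ergodic :
    (forall k : 'rV[int]_m, k != 0 ->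
      ~~ eigenvalue (twist theta k *m map_mx (real_complex R) P) 1) ->
  ergodic (mu \x Leb)%E F.
Proof.
move=> spectral; split=> [|A mA|A mA invA].
- exact: skew_product_measurable.
- exact: skew_product_preserves.
- exact: invariant_measure01.
Qed.

End markov.

(** * An eigenfunction obstructs ergodicity *)

(** The open upper half-plane with one of its two boundary rays, so that [-1]
    exchanges it with its complement among the nonzero numbers. *)
Definition half_plane (R : realType) (z : R[i]) : bool :=
  (0 < complex.Im z) || ((complex.Im z == 0) && (0 < complex.Re z)).

Lemma half_planeN (R : realType) (z : R[i]) : z != 0 ->
  half_plane (- z) = ~~ half_plane z.
Proof.
case: z => a b; rewrite eq_complex /half_plane /= !oppr_gt0 oppr_eq0.
by case: (ltrgt0P b) => //= _; case: (ltrgt0P a).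
Qed.

Section eigenfunction.
Variables (R : realType) (N m : nat) (P : 'M[R]_N.+1).
Hypothesis P_stochastic : stochastic P.
Variables (p : 'rV[R]_N.+1).
Variables (mu : probability (shift_space N) R)
  (Leb : probability (torus R m) R).
Hypotheses (mu_markov : markov_measure P p mu)
  (Leb_haar : haar_probability Leb).
Variable theta : 'I_N.+1 -> torus R m.
Local Notation T := (shift_space N * torus R m)%type.
Local Notation F := (skew_product theta).

Let M : probability T R := (mu \x Leb)%E.

Lemma rotation_preserves (s : torus R m) E : measurable E ->
  M [set z : T | E (z.1, z.2 + s)] = M E.
Proof.
have mH : measurable_fun setT (fun z : T => (z.1, z.2 + s)).
  apply: measurable_fun_pair; first exact: measurable_fst.
  exact: (measurableT_comp (torus_translation_measurable s) measurable_snd).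
pose m1 := pushforward_measure M mH.
suff m12 E' : measurable E' -> m1 E' = M E' by exact: m12.
apply: prod_measure_unique => [|n w B mB].
  exact: le_lt_trans (probability_le1 M measurableT) (ltry _).
have -> : m1 (cylinder n w `*` B) =
  M ((fun z : T => (z.1, z.2 + s)) @^-1` (cylinder n w `*` B)) by [].
have -> : (fun z : T => (z.1, z.2 + s)) @^-1` (cylinder n w `*` B) =
    cylinder n w `*` [set t | B (t + s)] by apply/seteqP; split=> -[].
have mC := cylinder_measurable n w.
have mBs : measurable [set t | B (t + s)] by exact: translate_measurable.
apply: etrans (product_box mu Leb mC mBs) _;
  apply: etrans (esym (product_box mu Leb mC mB)).
by congr (_ * _)%E; exact: Leb_haar.
Qed.

Definition inadmissible : set T := [set z | ~~ (0 < P (z.1 0%N) (z.1 1%N))].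
Local Notation Z := inadmissible.

Lemma inadmissible_null : measurable Z /\ M Z = 0%E.
Proof.
have ZE i j : Z `&` letter 0 i `*` setT `&` letter 1 j `*` setT =
    if 0 < P i j then set0 else cylinder 1 (shift_cons i (fun=> j)) `*` setT.
  apply/seteqP; split=> [[x t] [[Zx [/= <- _]] [/= <- _]]|].
    move: Zx; rewrite /Z /=; case: ifP => // _ _; split=> //.
    by case=> [|[|]].
  case: ifPn => // Pij [x t] [xw _].
  have x0 : x 0%N = i by exact: (xw 0%N).
  have x1 : x 1%N = j by exact: (xw 1%N).
  by rewrite /Z; split=> //; split=> //=; rewrite x0 x1.
have mcyl i j : measurable (cylinder 1 (shift_cons i (fun=> j)) `*` setT :
  set T).
  by apply: measurableX => //; exact: cylinder_measurable.
have Zij_measurable i j :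
  measurable (Z `&` letter 0 i `*` setT `&` letter 1 j `*` setT).
  by rewrite ZE; case: ifP.
have mZ : measurable Z.
  rewrite (_ : Z = \bigcup_i \bigcup_j (Z `&` letter 0 i `*` setT
    `&` letter 1 j `*` setT)).
    by apply: fin_bigcup_measurable => // i _; apply: fin_bigcup_measurable.
  apply/seteqP; split=> [[x t] Zx|[x t] [i _ [j _ [[]]]]//].
  by exists (x 0%N) => //; exists (x 1%N).
split=> //; rewrite (letter_sum M 0 mZ) big1// => i _.
rewrite (letter_sum M 1); last first.
  by apply: measurableI => //; exact: letter_box_measurable.
rewrite big1// => j _; rewrite ZE; case: ifPn => [_|Pij]; first exact: measure0.
apply: etrans (product_box mu Leb (cylinder_measurable _ _) measurableT) _.
rewrite mu_markov big_ord1 /=.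
have -> : P i j = 0.
  by apply/eqP; rewrite eq_le (proj1 P_stochastic) andbT leNgt.
by rewrite mulr0 mul0e.
Qed.

Section unimodular.
Variables (k : 'rV[int]_m) (v : 'I_N.+1 -> R[i]).
Hypothesis k_neq0 : k != 0.
Hypothesis v_neq0 : forall i, v i != 0.
Hypothesis v_edge : forall i j, 0 < P i j -> v i = chi k (theta i) * v j.

Let A0 : set T := [set z | half_plane (chi k z.2 * v (z.1 0%N))].

Let A0_measurable : measurable A0.
Proof.
rewrite (_ : A0 = \bigcup_i
  (letter 0 i `*` [set t | half_plane (chi k t * v i)])).
  apply: fin_bigcup_measurable => // i _; apply: measurableX.
    exact: letter_measurable.
  have mIm : measurable_fun setT (fun t : torus R m =>
      complex.Im (chi k t * v i)).
    rewrite (_ : (fun t => _) =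
      fun t => complex.Re ((0 -i* 1)%C * v i * chi k t)).
      exact: Re_chi_measurable.
    apply/funext => t; rewrite -mulrA (mulrC (chi _ _)).
    by case: (v i * chi k t) => a b /=; rewrite mul0r mulN1r sub0r opprK.
  have mRe : measurable_fun setT (fun t : torus R m =>
      complex.Re (chi k t * v i)).
    by under eq_fun do rewrite mulrC; exact: Re_chi_measurable.
  have mpos (f : torus R m -> R) : measurable_fun setT f ->
    measurable [set t | 0 < f t].
    move=> mf; have := mf measurableT _ (measurable_itv `]0, +oo[).
    by rewrite setTI; congr measurable; apply/seteqP; split=> t /=;
      rewrite in_itv /= andbT.
  rewrite (_ : [set t | _] = [set t | 0 < complex.Im (chi k t * v i)] `|`
    ((fun t => complex.Im (chi k t * v i)) @^-1` [set 0]) `&`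
      [set t | 0 < complex.Re (chi k t * v i)]).
    apply: measurableU; first exact: mpos.
    apply: measurableI; last exact: mpos.
    by rewrite -[X in measurable X]setTI; apply: mIm.
  apply/seteqP; split=> t; rewrite /half_plane /=.
    by move=> /orP[?|/andP[/eqP ? ?]]; [left | right].
  by move=> [->//|[/eqP -> ->]]; rewrite orbT.
apply/seteqP; split=> [[x t] ?|[x t] [i _ [/= <-]]//].
by exists (x 0%N).
Qed.

(** The half-plane condition is invariant along admissible transitions only;
    the lower limit of its preimages is invariant everywhere. *)
Let Ainf : set T := \bigcup_n
  \bigcap_(l in [set l | (n <= l)%N]) iter l F @^-1` A0.

Let iter_measurable n : measurable_fun setT (iter n F).
Proof.
elim: n => [|n IHn]; first exact: measurable_id.
exact: (measurableT_comp (skew_product_measurable theta) IHn).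
Qed.

Let iter_preimage_measurable n B : measurable B ->
  measurable (iter n F @^-1` B).
Proof.
by move=> mB; rewrite -[X in measurable X]setTI; exact: iter_measurable.
Qed.

Let Ainf_measurable : measurable Ainf.
Proof.
apply: bigcupT_measurable => n; apply: bigcap_measurable => [|l _].
  by exists n => /=.
exact: iter_preimage_measurable.
Qed.

Let Ainf_invariant : F @^-1` Ainf = Ainf.
Proof.
apply/seteqP; split=> z [n _ An].
  exists n.+1 => // -[//|l] /= nl; have := An l nl; by rewrite /= -iterSr.
by exists n => // l /= nl; rewrite /preimage /= -iterSr; apply: (An l.+1);
  exact: leqW.
Qed.

Let bad : set T := \bigcup_n iter n F @^-1` Z.

Let A0_step z : ~ Z z -> A0 (F z) <-> A0 z.
Proof.
rewrite /Z /A0 /= => /negP; rewrite negbK => /v_edge e.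
by rewrite -[Defs.shift z.1 0%N]/(z.1 1%N) chiD -mulrA -e.
Qed.

Let A0_iter z n : ~ bad z -> A0 (iter n F z) <-> A0 z.
Proof.
move=> zgood; elim: n => // n <-; rewrite iterS; apply: A0_step => Zn.
by apply: zgood; exists n.
Qed.

Let Ainf_A0 z : ~ bad z -> Ainf z <-> A0 z.
Proof.
move=> zgood; split=> [[n _ An]|Az].
  by apply/(A0_iter n zgood); exact: (An n (leqnn n)).
by exists 0%N => // l _; apply/A0_iter.
Qed.

(** The set [Ainf] agrees with [A0] outside the null set [bad], and the torus
    translation changing the sign of [chi k] exchanges [A0] with its
    complement; hence both have measure 1/2. *)
Lemma eigenfunction_not_ergodic : ~ ergodic (mu \x Leb)%E F.
Proof.
move=> [_ presF ergF].
have [mZ Z0] := inadmissible_null.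
have mbad : measurable bad by apply: bigcupT_measurable => n;
  exact: iter_preimage_measurable.
have iter0 n : M (iter n F @^-1` Z) = 0%E.
  elim: n => [|n IHn]; first exact: Z0.
  rewrite -IHn -[RHS]presF; last exact: iter_preimage_measurable.
  by congr (M _); apply/seteqP; split=> z; rewrite /preimage /= -iterSr.
have bad0 : M bad = 0%E.
  apply/eqP; rewrite eq_le measure_ge0 andbT.
  have mpre n : measurable (iter n F @^-1` Z)
    by exact: iter_preimage_measurable.
  apply: le_trans (measure_sigma_subadditive M mpre mbad (@subset_refl _ bad))
    _.
  by rewrite eseries0// => n _ _; exact: iter0.
have null_transfer B C : measurable B -> measurable C ->
    (forall z, ~ bad z -> B z -> C z) -> M C = 0%E -> M B = 0%E.
  move=> mB mC BC C0; apply: (@subset_measure0 _ _ _ M _ (C `|` bad)) => //.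
  - exact: measurableU.
  - by move=> z Bz; case: (pselect (bad z)) => [|/BC/(_ Bz)]; [right | left].
  - exact: null_set_setU.
have [s sE] := chi_minus1 R k_neq0.
have A0C : M (~` A0) = M A0.
  rewrite -(rotation_preserves s A0_measurable); congr (M _).
  have opp z : A0 (z.1, z.2 + s) <-> ~ A0 z.
    rewrite /A0 /= chiD sE mulrN1 mulNr half_planeN ?mulf_neq0 ?e2pi_neq0//.
    by split=> /negP.
  by apply/seteqP; split=> z /opp.
suff A00 : M A0 = 0%E.
  have := probability_setC M A0_measurable; rewrite A0C A00 sube0 => /eqP.
  by rewrite eq_sym onee_eq0.
have [Ainf0|AinfC0] := ergF _ Ainf_measurable Ainf_invariant.
  by apply: null_transfer Ainf0 => // z /Ainf_A0[].
rewrite -A0C; apply: null_transfer AinfC0.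
- exact: measurableC.
- exact: measurableC.
- by move=> z /Ainf_A0[AinfA _] zA /AinfA.
Qed.

End unimodular.
End eigenfunction.

Lemma ergodic_spectral (R : realType) (N m : nat) (P : 'M[R]_N.+1)
    (p : 'rV[R]_N.+1) (mu : probability (shift_space N) R)
    (Leb : probability (torus R m) R) (theta : 'I_N.+1 -> torus R m) :
  stochastic P -> irreducible P -> stationary P p -> markov_measure P p mu ->
  haar_probability Leb -> ergodic (mu \x Leb)%E (skew_product theta) ->
  forall k : 'rV[int]_m, k != 0 ->
    ~~ eigenvalue (twist theta k *m map_mx (real_complex R) P) 1.
Proof.
move=> P_stoch P_irr p_stat mu_markov haar ergF k k0.
apply/negP => /eigenvalue1_fixed[v v0 /twist_fixedE fixv].
have edge := twisted_fixed_edge P_stoch P_irr p_stat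
  (fun i => e2pi_norm1 (pairing k (theta i))) fixv.
have [j vj] : exists j, v j 0 != 0 by have /cV0Pn := v0.
have vN0 := twisted_neq0 P_stoch P_irr (fun i => e2pi_neq0 _) edge vj.
exact: (eigenfunction_not_ergodic P_stoch mu_markov haar k0 vN0 edge ergF).
Qed.

(** * The three conditions *)

Theorem theorem2p2 (R : realType) (N m : nat)
    (P : 'M[R]_N.+1) (P_stochastic : stochastic P)
    (P_irreducible : irreducible P)
    (piP : 'rV[R]_N.+1) (piP_stationary : stationary P piP)
    (mu : probability (shift_space N) R) (mu_markov : markov_measure P piP mu)
    (Leb : probability (torus R m) R) (Leb_haar : haar_probability Leb)
    (theta : 'I_N.+1 -> torus R m) :
  let ergodic_skew_product := ergodic (mu \x Leb)%E (skew_product theta) in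
  let spectral_condition :=
    forall k : 'rV[int]_m, k != 0 ->
      ~~ eigenvalue (twist theta k *m map_mx (real_complex R) P) 1 in
  let cycle_condition :=
    forall k : 'rV[int]_m, k != 0 ->
      exists2 c : seq 'I_N.+1, admissible_cycle P c &
        pairing k (\sum_(i <- c) theta i) != 0 in
  (ergodic_skew_product <-> spectral_condition) /\
  (spectral_condition <-> cycle_condition).
Proof.
move=> erg spec cyc; split; split.
- exact: ergodic_spectral P_stochastic P_irreducible piP_stationary mu_markov
    Leb_haar.
- exact: (spectral_ergodic P_stochastic P_irreducible piP_stationary mu_markov
    Leb_haar).
- move=> specP k k0; apply: contrapT => no_cycle.
  have /negP := specP k k0; apply;
    apply: trivial_cycles_eigenvalue => // c c_adm.
  by apply/eqP; apply: contra_notT no_cycle => c0; exists c.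
- move=> cycP k /cycP[c c_adm c0].
  exact: (cycle_not_eigenvalue P_stochastic P_irreducible piP_stationary c_adm
    c0).
Qed.
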